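(* For every integer $n\geq 4$, $R(\mathcal{B}^3C_n,\mathcal{B}^3C_n,\mathcal{B}^3C_3)=n+1$.
   Context: A hypergraph $\mathcal{H}=(V,E)$ consists of a finite non-empty vertex set $V=V(\mathcal{H})$ and a set $E=E(\mathcal{H})$ of distinct non-empty subsets of $V$ (hyperedges). It is $r$-uniform if all hyperedges have size $r$. The complete $r$-uniform hypergraph $\mathcal{K}_N^r$ has $N$ vertices and all $r$-subsets of its vertex set as hyperedges. For a graph $G$, a hypergraph $\mathcal{H}$ (whose vertex set contains $V(G)$, after identification) is called Berge-$G$ if there is a bijection $\Phi:E(G)\to E(\mathcal{H})$ with $e\subseteq\Phi(e)$ for every $e\in E(G)$. $\mathcal{B}^rG$ denotes the family of all $r$-uniform Berge-$G$ hypergraphs. $C_n$ is the cycle of length $n$. Thus a member of $\mathcal{B}^rC_n$ (a Berge cycle of length $n$) is given by distinct vertices $v_1,\dots,v_n$ and distinct hyperedges $h_1,\dots,h_n$ of size $r$ with $\{v_i,v_{i+1}\}\subseteq h_i$ for all $i$ (indices modulo $n$). For families $\mathcal{H}_1,\dots,\mathcal{H}_t$ of $r$-uniform hypergraphs, the Ramsey number $R(\mathcal{H}_1,\dots,\mathcal{H}_t)$ is the smallest integer $N$ such that every coloring of the hyperedges of $\mathcal{K}_N^r$ with $t$ colors $1,\dots,t$ contains, for some $1\le i\le t$, a (not necessarily induced) copy of some member of $\mathcal{H}_i$ all of whose hyperedges have color $i$. *)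

(* Defs.v *)
From mathcomp Require Import all_boot.

Set Implicit Arguments.
Unset Strict Implicit.
Unset Printing Implicit Defensive.

Record hypergraph := Hypergraph {
  hvert : finType;
  hedges : {set {set hvert}};
  hvert_nonempty : 0 < #|hvert|;
  hedges_nonempty : set0 \notin hedges }.

Definition uniform (r : nat) (H : hypergraph) : Prop :=
  forall h, h \in hedges H -> #|h| = r.

Record graph := Graph {
  gvert : finType;
  gedges : {set {set gvert}};
  gedges_card2 : forall e, e \in gedges -> #|e| = 2 }.

(* [ordS i] is i + 1 modulo n; the filter only discards the loop that would
   arise for n = 1, so for n >= 3 this is the usual cycle of length n. *)
Definition cycle_edges (n : nat) : {set {set 'I_n}} :=
  [set [set i; ordS i] | i : 'I_n & ordS i != i].

Lemma cycle_edges_card2 n e : e \in cycle_edges n -> #|e| = 2.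
Proof. by case/imsetP=> i; rewrite inE => ni ->; rewrite cards2 eq_sym ni. Qed.

Definition cycle_graph (n : nat) : graph := Graph (@cycle_edges_card2 n).

(* [f] is the identification of V(G) with a subset of V(H); only the values of
   [Phi] on E(G) are constrained, where it is a bijection onto E(H). *)
Definition is_berge (G : graph) (H : hypergraph) : Prop :=
  exists (f : gvert G -> hvert H) (Phi : {set gvert G} -> {set hvert H}),
    [/\ injective f,
        {in gedges G &, injective Phi},
        Phi @: gedges G = hedges H &
        forall e, e \in gedges G -> f @: e \subset Phi e].

Definition hfamily := hypergraph -> Prop.

Definition berge_family (r : nat) (G : graph) : hfamily :=
  fun H => uniform r H /\ is_berge G H.

Definition complete_edges (N r : nat) : {set {set 'I_N}} :=
  [set h : {set 'I_N} | #|h| == r].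

(* Colorings are total on sets of vertices, but only their values on the
   hyperedges of the complete r-uniform hypergraph are ever used. *)
Definition monochromatic_copy (N r t : nat) (c : {set 'I_N} -> 'I_t) (i : 'I_t)
    (H : hypergraph) : Prop :=
  exists f : hvert H -> 'I_N,
    injective f /\
    forall h, h \in hedges H ->
      f @: h \in complete_edges N r /\ c (f @: h) = i.

(* The colors are the positions in the list [Hs], so the default value of
   [nth] is never reached. *)
Definition ramsey_arrow (r : nat) (Hs : seq hfamily) (N : nat) : Prop :=
  forall c : {set 'I_N} -> 'I_(size Hs),
    exists (i : 'I_(size Hs)) (H : hypergraph),
      nth (fun=> False) Hs i H /\ monochromatic_copy r c i H.

Definition is_ramsey_number (r : nat) (Hs : seq hfamily) (N : nat) : Prop :=
  ramsey_arrow r Hs N /\ forall M, ramsey_arrow r Hs M -> N <= M.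

(* Main.v *)
Require Import Defs.
From mathcomp Require Import all_boot.
From mathcomp Require Import zify.

(** Lower bound. Fix two of the [n] vertices, [u] and [v]: colour a triple red
    if it avoids [u], blue if it contains [u] but avoids [v], green if it
    contains both. A red or blue Berge cycle of length [n] would have to pass
    through every vertex, hence use a triple through [u], respectively [v];
    and every other vertex lies in just one green triple, whereas a vertex of
    a Berge triangle lies in two of its hyperedges.

    Upper bound, by induction on [n] for the colourings of the triples of a
    set [S] of [n + 1] vertices. For [n = 4] and [n = 5] some colour has at
    least 4 of the 10 triples, respectively 7 of the 20, and a search shows
    that so many triples always contain the required Berge cycles.

    For [n >= 6] assume that there is no green Berge triangle and look at links:
    the link of [x] is the colouring of the pairs [ab] in [S - x] by the colours
    of the triples [xab]. Green links are star forests
    ([link_star_forest]), and some vertex [x] has a green link in which all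
    stars are small ([small_codegree_vertex]). By induction [S - x] contains
    a monochromatic, say red, Berge cycle [C] of length [m = n - 1], whose
    hyperedges all avoid [x]. If [x] cannot be inserted between two consecutive
    vertices of [C] ([berge_cycle_insert]), consecutive vertices cannot both
    have red neighbours in the link of [x], unless the two form an isolated
    red pair. Therefore [S - x] splits into a set [D] containing at least half
    of [C], on which red is a matching, and a set [I] of at most [|D| + 1]
    vertices, such that no pair between [I] and [D] is red. So the blue link
    contains a clique on [D] joined completely to [I], up to a matching and a
    forest of small stars. After deleting a suitable vertex of [I] it has a
    Hamiltonian path: this is [split_graph_hamiltonian], proved through the
    Bondy-Chvatal closure ([hamiltonian_of_closure]). Finally, a path
    [w_1 ... w_m] in the blue link of [x] is a blue Berge cycle of length
    [m + 1 = n]: the triples [x w_i w_(i+1)] join consecutive vertices, and two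
    further blue triples at the ends lead to [x] itself
    ([link_hamiltonian_berge_cycle]). *)

Set Implicit Arguments.
Unset Strict Implicit.
Unset Printing Implicit Defensive.

(** * Closure and Hamiltonian cycles *)

(** Counting missing neighbours instead of degrees keeps the estimates below
    free of subtractions: the degree condition [deg u + deg v >= |A|] becomes a
    condition [_ + _ + 2 <= |A|] on the sizes of these sets. *)
Definition nonnbrs (V : finType) (A : {set V}) (e : rel V) (u : V) : {set V} :=
  [set w in A | (w != u) && ~~ e u w].

Definition hamiltonian (V : finType) (A : {set V}) (e : rel V) : Prop :=
  exists s : seq V, [/\ uniq s, s =i A & cycle e s].

(** Ore's crossing argument: the condition leaves too few non-neighbours to
    block every position of the path, so [a] is adjacent to some successor
    whose predecessor is adjacent to the other end [x]; with these two edges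
    in place of the path edge between them, the path closes to a cycle. *)
Lemma crossing_cycle (V : finType) (A : {set V}) (e : rel V) (a x : V)
    (q : seq V) :
  symmetric e -> uniq (a :: rcons q x) -> a :: rcons q x =i A ->
  path e a (rcons q x) ->
  #|nonnbrs A e a| + #|nonnbrs A e x| + 2 <= #|A| -> hamiltonian A e.
Proof.
move=> sym_e; set p := a :: rcons q x => uniq_p pA path_p few.
have size_p : size p = #|A| by rewrite -(card_uniqP uniq_p); apply: eq_card.
have szp : size p = (size q).+2 by rewrite /= size_rcons.
(* Otherwise each of the [|A| - 1] positions of the path gives a non-neighbour
   of one of the two ends. *)
have [i /andP[eai exi]] : exists i : 'I_(size q).+1,
    e a (nth a p i.+1) && e x (nth a p i).
  apply/existsP; apply: contraLR few => /existsPn nocross.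
  rewrite -ltnNge -size_p szp addnS addnS !ltnS.
  pose X := [set i : 'I_(size q).+1 | ~~ e a (nth a p i.+1)].
  pose Y := [set i : 'I_(size q).+1 | ~~ e x (nth a p i)].
  have XY : X :|: Y = setT.
    by apply/setP=> i; rewrite !inE -negb_and nocross.
  have lt1 (i : 'I_(size q).+1) : i.+1 < size p by rewrite szp !ltnS leq_ord.
  have lt0 (i : 'I_(size q).+1) : i < size p by rewrite ltnW // lt1.
  have px : nth a p (size q).+1 = x by rewrite /= nth_rcons ltnn eqxx.
  have cX : #|X| <= #|nonnbrs A e a|.
    rewrite -(card_in_imset (f := fun i : 'I_(size q).+1 => nth a p i.+1)).
      apply/subset_leq_card/subsetP=> w /imsetP[i]; rewrite inE => nei ->.
      rewrite inE nei -pA mem_nth // andbT /=.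
      by rewrite -[eqbRHS]/(nth a p 0) -[eqbLHS]/(nth a p i.+1) nth_uniq.
    by move=> i j _ _ /eqP; rewrite nth_uniq // eqSS => /eqP; apply: val_inj.
  have cY : #|Y| <= #|nonnbrs A e x|.
    rewrite -(card_in_imset (f := fun i : 'I_(size q).+1 => nth a p i)).
      apply/subset_leq_card/subsetP=> w /imsetP[i]; rewrite inE => nei ->.
      rewrite inE nei -pA mem_nth // andbT /= -[eqbRHS]px.
      have -> : (nth a p i == nth a p (size q).+1) = (val i == (size q).+1).
        by rewrite nth_uniq // szp.
      by rewrite ltn_eqF ?ltn_ord.
    by move=> i j _ _ /eqP; rewrite nth_uniq // => /eqP; apply: val_inj.
  rewrite addn0.
  have := leq_card_setU X Y; rewrite XY cardsT card_ord.
  by move/leq_trans; apply; apply: leq_add.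
have lei : i.+1 < size p by rewrite szp !ltnS leq_ord.
have [b [t2 dp]] : exists b t2, drop i.+1 p = b :: t2.
  case: (drop i.+1 p) (size_drop i.+1 p) => [|b t2] sz; last by exists b, t2.
  by move: sz lei => /=; clear; lia.
have [t1 tp] : exists t1, take i.+1 p = a :: t1 by exists (take i (rcons q x)).
have nb : nth a p i.+1 = b.
  by rewrite -(cat_take_drop i.+1 p) nth_cat size_take lei ltnn subnn dp.
have lt1 : last a t1 = nth a p i.
  by rewrite -[LHS]/(last a (a :: t1)) -tp -nth_last size_take lei nth_take.
have lt2 : last b t2 = x.
  have : last a (take i.+1 p ++ drop i.+1 p) = x.
    by rewrite cat_take_drop /= last_rcons.
  by rewrite tp dp /= last_cat.
have rq : rcons q x = t1 ++ b :: t2.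
  by have := cat_take_drop i.+1 p; rewrite tp dp => -[].
have rp : rev (b :: t2) = x :: rev (belast b t2) by rewrite lastI rev_rcons lt2.
(* Follow the path from [a] to its [i]-th vertex, jump to the end [x] and come
   back along the reversed rest of the path. *)
exists (a :: t1 ++ rev (b :: t2)); split.
- have -> : a :: t1 ++ rev (b :: t2) = (a :: t1) ++ rev (b :: t2) by [].
  by rewrite (perm_uniq (s2 := p)) // /p rq -cat_cons perm_cat2l perm_rev.
- move=> w; rewrite -pA /p rq !inE !mem_cat mem_rev //.
move: path_p; rewrite rq cat_path /= => /and3P[pt1 _ pt2].
rewrite rcons_cat cat_path pt1 rp /= lt1 sym_e exi /=.
rewrite rcons_path -lt2.
have -> : path e (last b t2) (rev (belast b t2)).
  by rewrite rev_path; under eq_path do rewrite sym_e.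
have -> : last (last b t2) (rev (belast b t2)) = b.
  by case: (t2) => //= c t; rewrite rev_cons last_rcons.
by rewrite sym_e -nb eai.
Qed.

Definition add_edge (V : finType) (e : rel V) (u v : V) : rel V :=
  fun a b => [|| e a b, (a == u) && (b == v) | (a == v) && (b == u)].

(** If the Hamiltonian cycle uses the edge [uv], removing this edge leaves a
    Hamiltonian path of [e] from [u] to [v], which [crossing_cycle] closes. *)
Lemma add_edge_hamiltonian (V : finType) (A : {set V}) (e : rel V) (u v : V) :
  symmetric e -> u \in A -> v \in A -> u != v ->
  #|nonnbrs A e u| + #|nonnbrs A e v| + 2 <= #|A| ->
  hamiltonian A (add_edge e u v) -> hamiltonian A e.
Proof.
move=> sym_e uA vA uv few [s [uniq_s sA cyc]].
have [cyc_e|] := boolP (cycle e s); first by exists s.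
move=> ncyc.
have [x xs nex] : exists2 x, x \in s & ~~ e x (next s x).
  apply/hasP; apply: contraR ncyc; rewrite -all_predC => /allP he.
  apply: cycle_from_next => // x xs; have := he x xs; exact: negbNE.
have [i t rot_s] := rot_to xs.
have uniq_t : uniq (x :: t) by rewrite -rot_s rot_uniq.
have tA : x :: t =i A by move=> w; rewrite -sA -rot_s mem_rot.
have cyc_t : cycle (add_edge e u v) (x :: t) by rewrite -rot_s rot_cycle.
have next_t : next s x = next (x :: t) x by rewrite -rot_s next_rot.
case: t => [|a q] in rot_s uniq_t tA cyc_t next_t.
  move: uv; have := tA u; have := tA v; rewrite uA vA !inE.
  by move=> /eqP-> /eqP->; rewrite eqxx.
rewrite next_t /= eqxx in nex.
have xa : x != a by move: uniq_t; rewrite /= inE negb_or; case: (x != a).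
move: (cyc_t); rewrite /= => /andP[exa path_q].
have xauv : (x = u) /\ (a = v) \/ (x = v) /\ (a = u).
  move: exa; rewrite /add_edge (negbTE nex) /=.
  by case/orP=> /andP[/eqP-> /eqP->]; [left|right].
have few' : #|nonnbrs A e a| + #|nonnbrs A e x| + 2 <= #|A|.
  by case: xauv => -[-> ->]; rewrite // addnC [X in 2 + X]addnC addnC.
have uniq_q : uniq (a :: rcons q x).
  by rewrite -rcons_cons -(rot1_cons x) rot_uniq.
have qA : a :: rcons q x =i A.
  by move=> w; rewrite -rcons_cons -(rot1_cons x) mem_rot tA.
apply: (crossing_cycle sym_e uniq_q qA _ few').
have stay b c : b != a -> c != a -> add_edge e u v b c -> e b c.
  rewrite /add_edge => ba ca.
  by case: xauv ba ca => -[_ <-] /negbTE-> /negbTE->; rewrite ?andbF ?orbF.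
have aA : a \in A by rewrite -qA mem_head.
have xA : x \in A by rewrite -qA inE mem_rcons mem_head orbT.
move: path_q uniq_q qA; case: q {rot_s uniq_t tA cyc_t next_t} => [|b q].
  move=> _ _ qA.
  have /subset_leq_card : A \subset [set a; x].
    by apply/subsetP=> w; rewrite -qA !inE.
  have : 0 < #|nonnbrs A e x|.
    by apply/card_gt0P; exists a; rewrite inE aA eq_sym xa.
  have : 0 < #|nonnbrs A e a|.
    by apply/card_gt0P; exists x; rewrite inE xA xa sym_e.
  by rewrite cards2; move: few'; case: (a != x); clear; lia.
rewrite rcons_cons /= => /andP[ab path_q] /andP[na uniq_q] _.
have /negbTE na' : a \notin b :: rcons q x by [].
have ba : b != a by apply: contraFneq na' => ->; rewrite mem_head.
have bx : b != x.
  by apply: contraTneq uniq_q => ->; rewrite mem_rcons mem_head.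
apply/andP; split.
  move: ab; rewrite /add_edge; case/or3P=> // /andP[/eqP Ea /eqP Eb].
    by case: xauv => -[? ?]; subst; rewrite eqxx in bx xa ba *.
  by case: xauv => -[? ?]; subst; rewrite eqxx in bx xa ba *.
apply: (sub_in_path (P := [pred w | w != a])) path_q.
  by move=> c d; apply: stay.
apply/allP=> w wq /=; apply: contraFneq na' => <-; exact: wq.
Qed.

Definition closed_on (V : finType) (A : {set V}) (e : rel V) : Prop :=
  forall u v, u \in A -> v \in A -> u != v ->
    #|nonnbrs A e u| + #|nonnbrs A e v| + 2 <= #|A| -> e u v.

Definition complete_on (V : finType) (A : {set V}) (e : rel V) : Prop :=
  forall u v, u \in A -> v \in A -> u != v -> e u v.

Lemma next_neq (T : eqType) (s : seq T) (v : T) :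
  uniq s -> 1 < size s -> v \in s -> next s v != v.
Proof.
move=> uq s1 vs; have [i t rot_s] := rot_to vs.
have := s1; have := uq; rewrite -(next_rot i uq) -(rot_uniq i) -(size_rot i) rot_s.
case: t {rot_s} => //= a t; rewrite eqxx inE negb_or eq_sym.
by case/andP=> /andP[].
Qed.

Lemma complete_hamiltonian (V : finType) (A : {set V}) (e : rel V) :
  1 < #|A| -> complete_on A e -> hamiltonian A e.
Proof.
move=> A1 comp; exists (enum A); split; rewrite ?enum_uniq //.
  by move=> w; rewrite mem_enum.
apply: cycle_from_next (enum_uniq _) _ => w wA.
have nA : next (enum A) w \in A by rewrite -mem_enum mem_next.
have nw := next_neq (enum_uniq A) _ wA.
rewrite mem_enum in wA; apply: comp => //.
by rewrite eq_sym nw // -cardE.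
Qed.

(** The Bondy-Chvatal closure, in the form of a reasoning principle: to find a
    Hamiltonian cycle one may assume that any two vertices with few missing
    neighbours are adjacent, and has only to prove completeness. The relation
    [e'] is the closure of [e]. *)
Theorem hamiltonian_of_closure (V : finType) (A : {set V}) (e : rel V) :
  1 < #|A| -> symmetric e ->
  (forall e', symmetric e' -> subrel e e' -> closed_on A e' ->
     complete_on A e') ->
  hamiltonian A e.
Proof.
move=> A1.
have [k] := ubnP #|[set p : V * V | ~~ e p.1 p.2]|.
elim: k e => // k IH e; rewrite ltnS => le_k sym_e closure_e.
pose joinable p := [&& p.1 \in A, p.2 \in A, p.1 != p.2, ~~ e p.1 p.2
  & #|nonnbrs A e p.1| + #|nonnbrs A e p.2| + 2 <= #|A|].
have [/existsP[[u v] /and5P[uA vA uv neuv few]]|none] :=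
    boolP [exists p : V * V, joinable p].
  apply: (add_edge_hamiltonian sym_e uA vA uv few).
  have sub : subrel e (add_edge e u v) by move=> a b; rewrite /add_edge => ->.
  apply: IH.
  - apply: leq_trans le_k; apply: proper_card; apply/properP; split.
      apply/subsetP=> -[a b]; rewrite !inE /=; exact: contraNN (sub a b).
    exists (u, v); rewrite !inE //= negbK /add_edge !eqxx orbT //.
  - move=> a b; rewrite /add_edge sym_e [(a == u) && _]andbC.
    by rewrite [(a == v) && _]andbC; congr (_ || _); rewrite orbC.
  move=> e' sym' sub' closed'; apply: closure_e => // a b /sub; exact: sub'.
apply: complete_hamiltonian => //; apply: closure_e => // u v uA vA uv few.
apply: contraR none => neuv; apply/existsP; exists (u, v).
by rewrite /joinable /= uA vA uv neuv few.
Qed.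

(** * Nearly complete split graphs *)

Definition nbrs (V : finType) (A : {set V}) (e : rel V) (a : V) : {set V} :=
  [set b in A | e a b].

(** For a symmetric relation this excludes triangles and paths with three edges,
    which leaves disjoint stars. *)
Definition star_forest (V : finType) (e : rel V) : Prop :=
  forall a b c d, e a b -> e a c -> b != c -> e b d -> d = a.

Lemma another_member (V : finType) (A : {set V}) (b : V) :
  1 < #|A| -> exists2 c, c \in A & c != b.
Proof.
case/card_gt1P=> c [d [cA dA cd]].
by have [cb|] := eqVneq c b; [exists d; rewrite // -cb eq_sym|exists c].
Qed.

Lemma star_forest_leaf (V : finType) (A : {set V}) (e : rel V) (a b : V) :
  star_forest e -> e a b -> 1 < #|nbrs A e a| -> #|nbrs A e b| <= 1.
Proof.
move=> star ab /(another_member b)[c]; rewrite inE => /andP[_ ac] cb.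
rewrite leqNgt; apply/negP=> /(another_member a)[d].
rewrite inE => /andP[_ bd] /eqP[]; apply: star ab ac _ bd.
by rewrite eq_sym.
Qed.

(** The blue graph is a clique on [D] completely joined to [I], except for the
    small green stars and, inside [D], a red matching. The extra vertex [x] is
    joined to everything, so a Hamiltonian cycle here amounts to a blue
    Hamiltonian path on [D] and [I - w0]. The closure is completed in four
    stages: pairs in [D] with an end of green degree at most 1, then all pairs
    in [D], then the pairs between [D] and [I], and last the pairs in [I]. *)
Lemma split_graph_hamiltonian (V : finType) (I D : {set V}) (x w0 : V)
    (blue green red : rel V) (m : nat) :
  4 < m -> [disjoint I & D] -> x \notin I -> x \notin D ->
  #|I| + #|D| = m.+1 -> #|I| <= #|D|.+1 -> w0 \in I ->
  symmetric blue -> symmetric green -> star_forest green ->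
  (forall a, a \in I :|: D -> 2 * #|nbrs (I :|: D) green a| + 2 <= m) ->
  (forall i d, i \in I -> d \in D -> blue d i || green d i) ->
  (forall a b, a \in D -> b \in D -> a != b ->
     [|| blue a b, green a b | red a b]) ->
  (forall d, d \in D -> #|nbrs D red d| <= 1) ->
  hamiltonian (x |: (I :\ w0 :|: D)) (fun a b => [|| a == x, b == x | blue a b]).
Proof.
move=> m5 disID xI xD sumID leID w0I sym_b sym_g star deg cross inD red1.
set A := x |: _; set e0 := (fun a b => _).
have cardI : #|I| = #|I :\ w0|.+1 by rewrite (cardsD1 w0) w0I.
have disI'D : [disjoint I :\ w0 & D].
  by apply: disjointWl disID; apply: subsetDl.
have cardA : #|A| = m.+1.
  rewrite cardsU1 inE negb_or xD andbT in_setD1 (negbTE xI) andbF /=.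
  by rewrite cardsU disjoint_setI0 // cards0; move: cardI sumID; clear; lia.
have sumI'D : #|I :\ w0| + #|D| = m by move: cardI sumID; clear; lia.
have leI'D : #|I :\ w0| <= #|D| by move: cardI leID; clear; lia.
apply: hamiltonian_of_closure.
- by rewrite cardA; move: m5; clear; lia.
- by move=> a b; rewrite /e0 sym_b orbCA.
move=> e sym_e sub closed_e.
have nblue a b : ~~ e a b -> ~~ blue a b.
  by apply: contraNN => ab; apply: sub; rewrite /e0 ab !orbT.
have ex a : e a x by apply: sub; rewrite /e0 eqxx orbT.
pose g a := #|nbrs (I :|: D) green a|.
pose nn a := #|nonnbrs A e a|.
have inW_D d : d \in D -> d \in I :|: D by rewrite inE => ->; rewrite orbT.
have inW_I i : i \in I :\ w0 -> i \in I :|: D.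
  by rewrite !inE => /andP[_ ->].
have inA_D d : d \in D -> d \in A by rewrite !inE => ->; rewrite !orbT.
have inA_I i : i \in I :\ w0 -> i \in A by rewrite !inE => ->; rewrite orbT.
have join a b : a \in A -> b \in A -> a != b -> nn a + nn b + 2 <= m.+1 -> e a b.
  by rewrite -cardA; apply: closed_e.
have nn_cases a b : b \in nonnbrs A e a ->
    [/\ b \in I :\ w0 :|: D, b != a & ~~ e a b].
  rewrite inE => /and3P[+ ba neab]; rewrite in_setU1 => /orP[/eqP bx|bW] //.
  by rewrite bx ex in neab.
have crossN d i : i \in I :\ w0 -> d \in D -> ~~ e d i -> green d i.
  move=> iI dD /nblue nb; have := @cross i d; rewrite (negbTE nb) /=; apply=> //.
  by case/setD1P: iI.
have nnD d : d \in D -> nn d <= g d + 1.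
  move=> dD; apply: (@leq_trans #|nbrs (I :|: D) green d :|: nbrs D red d|).
    apply/subset_leq_card/subsetP=> b /nn_cases[]; rewrite in_setU.
    case/orP=> [bI|bD] bd neb.
      by rewrite !inE (crossN _ _ bI) //; have /setD1P[_ ->] := bI.
    have := inD _ _ dD bD; rewrite eq_sym bd (negbTE (nblue _ _ neb)) /=.
    by rewrite !inE bD orbT /=; apply.
  apply: leq_trans (leq_card_setU _ _) _.
  by rewrite leq_add2l red1.
have nnI i : i \in I :\ w0 -> nn i <= #|I :\ w0|.-1 + g i.
  move=> iI.
  apply: (@leq_trans #|(I :\ w0 :\ i) :|: nbrs (I :|: D) green i|).
    apply/subset_leq_card/subsetP=> b /nn_cases[]; rewrite in_setU.
    case/orP=> [bI|bD] bi neb; rewrite in_setU in_setD1 bi ?bI //=.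
    rewrite [_ \in nbrs _ _ _]inE (inW_D _ bD) sym_g (crossN _ _ iI bD) ?orbT //.
    by rewrite sym_e.
  apply: leq_trans (leq_card_setU _ _) _.
  by rewrite (cardsD1 i (I :\ w0)) iI.
have DD1 a b : a \in D -> b \in D -> a != b -> g a <= 1 -> e a b.
  move=> aD bD ab ga; apply: join; rewrite ?inA_D //.
  have := nnD a aD; have := nnD b bD; have := deg b (inW_D b bD).
  by rewrite -/(g b); move: ga m5; clear; lia.
(* Two star centres in [D] can only be separated by a red edge. Their leaves in
   [I] are distinct, which is what makes the numbers of missing neighbours
   small enough. *)
have DD a b : a \in D -> b \in D -> a != b -> e a b.
  move=> aD bD ab; apply: contraT => neab.
  have ga : 1 < g a by rewrite ltnNge; apply: contraNN neab; apply: DD1.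
  have gb : 1 < g b.
    rewrite ltnNge; apply: contraNN neab => gb; rewrite sym_e.
    by apply: DD1; rewrite // eq_sym.
  have redN c d : c \in D -> d \in D -> c != d -> ~~ e c d -> red c d.
    move=> cD dD cd necd; have := inD c d cD dD cd.
    rewrite (negbTE (nblue _ _ necd)) /= => /orP[gcd|//].
    case/negP: necd; have [gc|gc] := leqP (g c) 1; first exact: DD1.
    rewrite sym_e; apply: DD1; rewrite // 1?eq_sym //.
    exact: star_forest_leaf star gcd gc.
  have lim c d : c \in D -> d \in D -> c != d -> ~~ e c d ->
      nn c <= 1 + #|nbrs (I :\ w0) green c|.
    move=> cD dD cd necd.
    apply: (@leq_trans #|d |: nbrs (I :\ w0) green c|); last first.
      by rewrite cardsU1; case: (_ \in _); clear; lia.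
    apply/subset_leq_card/subsetP=> z /nn_cases[]; rewrite in_setU.
    case/orP=> [zI|zD] zc nez; rewrite in_setU1.
      by rewrite [_ \in nbrs _ _ _]inE zI crossN ?orbT.
    have := red1 c cD; rewrite leqNgt; apply: contraR; rewrite negb_or.
    case/andP=> zd _; apply/card_gt1P; exists z, d; rewrite !inE zD dD zd.
    by rewrite !redN // eq_sym.
  case/negP: (neab); apply: join; rewrite ?inA_D //.
  have := lim a b aD bD ab neab.
  have := lim b a bD aD; rewrite eq_sym ab sym_e => /(_ isT neab).
  have : #|nbrs (I :\ w0) green a| + #|nbrs (I :\ w0) green b| <= #|I :\ w0|.
    have dis : [disjoint nbrs (I :\ w0) green a & nbrs (I :\ w0) green b].
      rewrite -setI_eq0; apply/eqP/setP=> z; rewrite !inE; apply/negP.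
      case/andP=> /andP[_ az] /andP[_ bz].
      have [c] := another_member z ga; rewrite inE => /andP[_ ac] cz.
      have E : b = a by apply: (star a z c b); rewrite 1?eq_sym // sym_g.
      by rewrite E eqxx in ab.
    move: dis; rewrite -(leq_card_setU _ _) => /eqP <-.
    by apply/subset_leq_card/subsetP=> z; rewrite !inE => /orP[]/andP[->].
  by move: sumI'D leI'D m5; clear; lia.
(* A missing pair is green, so one of its ends is a leaf. *)
have DI d i : d \in D -> i \in I :\ w0 -> e d i.
  move=> dD iI; apply: contraT => nedi.
  have gdi := crossN _ _ iI dD nedi.
  have gd := deg d (inW_D _ dD); have gi := deg i (inW_I _ iI).
  have leaf : g d <= 1 \/ g i <= 1.
    have [|gd1] := leqP (g d) 1; [by left|right].
    exact: star_forest_leaf star gdi gd1.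
  have nnd : nn d <= g d.
    apply/subset_leq_card/subsetP=> b /nn_cases[]; rewrite in_setU.
    case/orP=> [bI|bD] bd neb; last by rewrite DD // eq_sym in neb.
    by rewrite inE (inW_I _ bI) crossN.
  have ltI : 0 < #|I :\ w0| by apply/card_gt0P; exists i.
  case/negP: nedi; apply: (join d i (inA_D d dD) (inA_I i iI)).
    by apply: contraTneq dD => ->; rewrite (disjointFr disI'D iI).
  have := nnI i iI; rewrite -/(g d) -/(g i) in gd gi.
  by move: gd gi leaf ltI leI'D sumI'D nnd; clear; lia.
have II i j : i \in I :\ w0 -> j \in I :\ w0 -> i != j -> e i j.
  have nnI' k : k \in I :\ w0 -> nn k <= #|I :\ w0|.-1.
    move=> kI; rewrite (cardsD1 k (I :\ w0)) kI.
    apply/subset_leq_card/subsetP=> b /nn_cases[]; rewrite in_setU.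
    case/orP=> [bI|bD] bk neb; first by rewrite in_setD1 bk bI.
    by rewrite sym_e DI in neb.
  move=> iI jI ij; apply: join; rewrite ?inA_I //.
  have := nnI' i iI; have := nnI' j jI.
  by move: leI'D sumI'D m5; clear; lia.
move=> a b; rewrite !in_setU !in_set1.
case/or3P=> [/eqP->|aI|aD] /or3P[/eqP->|bI|bD] ab //; rewrite ?ex //.
- by rewrite sym_e ex.
- by rewrite sym_e ex.
- exact: II.
- by rewrite sym_e DI.
- exact: DI.
- exact: DD.
Qed.

(** * Berge cycles and links *)

(** A Berge cycle is encoded as the list of the pairs (vertex, hyperedge leading
    to the next vertex). This relation between consecutive pairs does not
    depend on the hyperedge of the second one, so hyperedges can be exchanged
    locally. *)
Definition incident (V : finType) : rel (V * {set V}) :=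
  fun p q => (p.1 \in p.2) && (q.1 \in p.2).

Definition berge_cycle (V : finType) (E : {set {set V}}) (l : nat) : Prop :=
  exists s : seq (V * {set V}),
    [/\ size s = l, cycle (@incident V) s, uniq (unzip1 s), uniq (unzip2 s)
      & {subset unzip2 s <= E}].

Definition link (V : finType) (E : {set {set V}}) (x : V) : rel V :=
  fun a b => [set x; a; b] \in E.

Lemma link_sym (V : finType) (E : {set {set V}}) (x : V) :
  symmetric (link E x).
Proof. by move=> a b; rewrite /link -setUA [[set a] :|: _]setUC setUA. Qed.

Lemma triple_uniq (V : finType) (a b c : V) :
  #|[set a; b; c]| = 3 -> [/\ a != b, a != c & b != c].
Proof.
rewrite -setUA cardsU1 cards2 !inE negb_or.
by case: (a != b) (a != c) (b != c) => [] [] [].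
Qed.

Lemma mem_link_edges (V : finType) (x w : V) (p : seq V) (T : {set V}) :
  T \in pairmap (fun a b => [set x; a; b]) w p ->
  exists p1 c d p2, w :: p = p1 ++ c :: d :: p2 /\ T = [set x; c; d].
Proof.
elim: p w => //= h p IH w; rewrite inE => /orP[/eqP->|/IH[p1 [c [d [p2 [E ->]]]]]].
  by exists [::], w, h, p.
by exists (w :: p1), c, d, p2; rewrite E.
Qed.

Lemma uniq_link_edges (V : finType) (x w : V) (p : seq V) :
  uniq (x :: w :: p) -> uniq (pairmap (fun a b => [set x; a; b]) w p).
Proof.
elim: p w => //= h p IH w /and3P[]; rewrite !inE !negb_or.
move=> /and3P[xw xh xp] /andP[wh wp] uq.
rewrite IH ?andbT; last by rewrite /= inE negb_or xh xp.
apply/negP=> /mem_link_edges[p1 [c [d [p2 [E /setP/(_ w)]]]]].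
rewrite !inE eqxx orbT (eq_sym w x) (negbTE xw) /= => /esym wcd.
have : w \in h :: p.
  by rewrite E mem_cat !inE; case/orP: wcd => ->; rewrite !orbT.
by rewrite inE (negbTE wh) (negbTE wp).
Qed.

(** The path itself only uses triples [x w_i w_(i+1)]; the hyperedges [t1] and
    [t2] connect its two ends to [x]. *)
Lemma link_path_berge_cycle (V : finType) (E : {set {set V}}) (x w : V)
    (p : seq V) (t1 t2 : {set V}) :
  let edges := pairmap (fun a b => [set x; a; b]) w p in
  uniq (x :: w :: p) -> path (link E x) w p ->
  t1 \in E -> x \in t1 -> w \in t1 -> t2 \in E -> x \in t2 -> last w p \in t2 ->
  t1 \notin edges -> t2 \notin edges -> t1 != t2 ->
  berge_cycle E (size p).+2.
Proof.
move=> edges uq pth t1E xt1 wt1 t2E xt2 zt2 t1n t2n t12.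
have sz : size edges = size p by rewrite size_pairmap.
pose s := zip (x :: w :: p) (t1 :: rcons edges t2).
have u1 : unzip1 s = x :: w :: p by rewrite unzip1_zip //= size_rcons sz.
have u2 : unzip2 s = t1 :: rcons edges t2 by rewrite unzip2_zip //= size_rcons sz.
exists s; split.
- by rewrite size_zip /= size_rcons sz minnn.
- suff walk y (t : {set V}) q v : y \in t -> v \in t -> last v q \in t2 ->
      path (@incident V) (y, t)
        (rcons (zip (v :: q) (rcons (pairmap (fun a b => [set x; a; b]) v q) t2))
           (x, t1)) by exact: walk.
  elim: q y t v => [|h q IH] y t v yt vt zt /=.
    by rewrite /incident /= yt vt zt xt2.
  by rewrite {1}/incident /= yt vt; apply: IH; rewrite // !inE eqxx ?orbT.
- by rewrite u1.
- rewrite u2 cons_uniq mem_rcons inE negb_or t12 t1n rcons_uniq t2n.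
  exact: uniq_link_edges.
rewrite u2 => T; rewrite inE mem_rcons inE => /or3P[/eqP->|/eqP->|] //.
move: pth; rewrite /edges.
elim: (p) w {uq wt1 zt2 t1n t2n sz s u1 u2 edges} => //= h q IH w.
by case/andP=> wh pth; rewrite inE => /orP[/eqP->|] //; apply: IH.
Qed.

(** Removing [x] from the Hamiltonian cycle leaves a path in the link. It
    becomes a Berge cycle once each end has a link edge outside the path, and
    these two are distinct. Both ends having degree at least 2, this can only
    fail if the ends are adjacent; then the path closes to a cycle in the link,
    which may be cut open next to the vertex [d] of degree at least 3. Extra
    link edges may lead to a vertex of [W] off the path. *)
Lemma link_hamiltonian_berge_cycle (V : finType) (E : {set {set V}})
    (W W' : {set V}) (x d : V) :
  {in E, forall T : {set V}, #|T| = 3} -> W' \subset W -> x \notin W ->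
  2 < #|W'| -> {in W', forall w, 1 < #|nbrs W (link E x) w|} ->
  d \in W' -> 2 < #|nbrs W (link E x) d| ->
  hamiltonian (x |: W') (fun a b => [|| a == x, b == x | link E x a b]) ->
  berge_cycle E #|W'|.+1.
Proof.
move=> card3 subW xW W'2 deg2 dW' deg3 [s [uq_s sA cyc]].
have xW' : x \notin W' by apply: contra xW; apply: (subsetP subW).
(* [a] and [b] are the ends of the extra link edges. The default value [x] is
   never reached, as the path has at least two vertices. *)
have finish w p a b : uniq (w :: p) -> w :: p =i W' -> path (link E x) w p ->
    link E x w a -> a != head w p -> link E x (last w p) b ->
    b != last x (belast w p) -> ~~ ((a == last w p) && (b == w)) ->
    berge_cycle E #|W'|.+1.
  move=> uq pW' pth wa ah zb bl ab.
  have uqx : uniq (x :: w :: p) by rewrite cons_uniq pW' xW'.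
  have szp : #|W'| = (size p).+1 by rewrite -(eq_card pW') (card_uniqP uq).
  have wW' : w \in W' by rewrite -pW' mem_head.
  have zW' : last w p \in W' by rewrite -pW' mem_last.
  have wx : w != x by apply: contraTneq wW' => ->.
  have zx : last w p != x by apply: contraTneq zW' => ->.
  have [xw' xa wa'] := triple_uniq (card3 _ wa).
  have [_ xb zb'] := triple_uniq (card3 _ zb).
  rewrite szp; apply: (link_path_berge_cycle (w := w) (t1 := [set x; w; a])
    (t2 := [set x; last w p; b]) uqx) => //; rewrite ?inE ?eqxx ?orbT //.
  - apply/negP=> /mem_link_edges[p1 [c [e [p2 [Ep /setP ET]]]]].
    move: (ET w) (ET a); rewrite !inE !eqxx !orbT (negbTE wx).
    rewrite (eq_sym a x) (negbTE xa) /=.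
    case: p1 Ep => [|w' p1] [Ew Ep]; subst.
      rewrite (eq_sym a) (negbTE wa') /= => _ /esym/eqP Ea.
      by rewrite Ea eqxx in ah.
    move=> /esym wce _; move: uq => /= /andP[]; rewrite mem_cat !inE.
    by case/orP: wce => /eqP->; rewrite eqxx !orbT.
  - apply/negP=> /mem_link_edges[p1 [c [e [p2 [Ep /setP ET]]]]].
    move: (ET (last w p)) (ET b); rewrite !inE !eqxx !orbT (negbTE zx).
    rewrite (eq_sym b x) (negbTE xb) /=.
    have [Ep2|p2n] := eqVneq p2 [::].
      have Er : rcons (belast w p) (last w p) = rcons (rcons p1 c) e.
        by rewrite -lastI Ep Ep2 -!cats1 -catA.
      have [Eb Ee] := rcons_inj Er.
      rewrite Ee => _ /esym; rewrite -Ee (eq_sym b (last _ _)) (negbTE zb') orbF.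
      move=> /eqP Ec.
      by rewrite Eb last_rcons Ec eqxx in bl.
    have zp2 : last w p \in p2.
      have -> : last w p = last w (w :: p) by [].
      rewrite Ep last_cat /=; case: (p2) p2n => //= z q _; exact: mem_last.
    move: uq; rewrite Ep cat_uniq /= !inE => /and3P[_ _ /and3P[+ + _]].
    rewrite negb_or => /andP[_ cp2] ep2 /esym/orP[]/eqP Ez _.
      by rewrite -Ez zp2 in cp2.
    by rewrite -Ez zp2 in ep2.
  apply: contraNneq ab => /setP ET.
  move: (ET w) (ET (last w p)); rewrite !inE !eqxx !orbT.
  rewrite (negbTE wx) (negbTE zx) /=.
  have wz : w != last w p.
    have : 1 < size (w :: p) by rewrite /= -szp ltnW.
    case: (p) uq => //= h q /andP[+ _] _.
    by apply: contraNneq => ->; apply: mem_last.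
  rewrite (eq_sym (last w p) w) (negbTE wz) /= => /esym bw za.
  by rewrite (eq_sym a) za (eq_sym b) bw.
have xs : x \in s by rewrite sA setU11.
have [i q rot_s] := rot_to xs.
have qW' : q =i W'.
  move=> w; have := sA w; rewrite -(mem_rot i) rot_s !inE.
  have := uq_s; rewrite -(rot_uniq i) rot_s /= => /andP[xq _].
  by have [->|] := eqVneq w x; first by rewrite (negbTE xq) (negbTE xW').
have uq_q : uniq q by have := uq_s; rewrite -(rot_uniq i) rot_s => /andP[].
have szq : size q = #|W'| by rewrite -(card_uniqP uq_q); apply: eq_card.
have : cycle (fun a b => [|| a == x, b == x | link E x a b]) (x :: q).
  by rewrite -rot_s rot_cycle.
case: q qW' uq_q szq {rot_s} => [|w p] qW' uq szq; first by rewrite -szq in W'2.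
rewrite /= rcons_path => /and3P[_ pth _].
have {}pth : path (link E x) w p.
  apply: (sub_in_path (P := [pred v | v != x])) pth.
    by move=> a b /=; rewrite !inE => /negbTE-> /negbTE->.
  apply/allP=> v; rewrite qW' => vW' /=; by apply: contraTneq vW' => ->.
have [cl|ncl] := boolP (link E x (last w p) w).
  have dp : d \in w :: p by rewrite qW'.
  have [j r rot_p] := rot_to dp.
  have uq_r : uniq (d :: r) by rewrite -rot_p rot_uniq.
  have rW' : d :: r =i W' by move=> v; rewrite -rot_p mem_rot qW'.
  have : cycle (link E x) (d :: r) by rewrite -rot_p rot_cycle /= rcons_path pth.
  rewrite /= rcons_path => /andP[pth_r cl_r].
  have szr : size (d :: r) = #|W'| by rewrite -rot_p size_rot.
  have /card_gt0P[a] : 0 < #|nbrs W (link E x) d :\: [set head d r; last d r]|.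
    rewrite cardsD subn_gt0; apply: leq_ltn_trans deg3.
    apply: leq_trans (subset_leq_card (subsetIr _ _)) _.
    by rewrite cards2; case: (_ != _).
  rewrite !inE negb_or => /andP[/andP[ah al] /andP[_ da]].
  apply: (finish d r a d) => //; last by rewrite (negbTE al).
  case: r szr uq_r {rot_p rW' pth_r cl_r ah al} => [|h [|h' r]] szr;
    try by rewrite -szr in W'2.
  case/andP=> + _; apply: contraNneq => ->; have /= := mem_last h (belast h' r).
  rewrite in_cons => /orP[/eqP->|/mem_belast]; first by rewrite mem_head.
  by rewrite [in X in _ -> X]in_cons orbC => ->.
have wW' : w \in W' by rewrite -qW' mem_head.
have zW' : last w p \in W' by rewrite -qW' mem_last.
have [a] := another_member (head w p) (deg2 w wW').
rewrite inE => /andP[_ wa] ah.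
have [b] := another_member (last x (belast w p)) (deg2 _ zW').
rewrite inE => /andP[_ zb] bl.
apply: (finish w p a b) => //; apply: contraNN ncl => /andP[/eqP az _].
by rewrite link_sym -az.
Qed.

(** * Hypergraphs without Berge triangles *)

Lemma berge_triangle (V : finType) (E : {set {set V}}) (a b c : V)
    (T1 T2 T3 : {set V}) :
  uniq [:: a; b; c] -> uniq [:: T1; T2; T3] ->
  T1 \in E -> T2 \in E -> T3 \in E ->
  a \in T1 -> b \in T1 -> b \in T2 -> c \in T2 -> c \in T3 -> a \in T3 ->
  berge_cycle E 3.
Proof.
move=> uv uT T1E T2E T3E aT1 bT1 bT2 cT2 cT3 aT3.
exists [:: (a, T1); (b, T2); (c, T3)]; split=> //=.
  by rewrite /incident /= aT1 bT1 bT2 cT2 cT3 aT3.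
by move=> T; rewrite !inE => /or3P[]/eqP->.
Qed.

Lemma link_rot (V : finType) (E : {set {set V}}) (a b c : V) :
  link E a b c = link E b a c.
Proof. by rewrite /link [[set a; b]]setUC. Qed.

(** In a triple [abc] at most one pair lies in a further triple: triples through
    [ab] and [ac] would form a Berge triangle with [abc]. *)
Lemma one_heavy_pair (V : finType) (E : {set {set V}}) (a b c d e : V) :
  {in E, forall T : {set V}, #|T| = 3} -> ~ berge_cycle E 3 ->
  link E a b c -> link E a b d -> link E a c e -> d != c -> e != b -> False.
Proof.
move=> card3 tri abc abd ace dc eb; apply: tri.
have [ab ac bc] := triple_uniq (card3 _ abc).
have [_ ad bd] := triple_uniq (card3 _ abd).
have [_ ae ce] := triple_uniq (card3 _ ace).
apply: (berge_triangle (a := a) (b := b) (c := c) _ _ abd abc ace);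
  rewrite ?inE ?eqxx ?orbT //.
  by rewrite /= !inE negb_or ab ac bc.
rewrite /= !inE negb_or andbT -andbA; apply/and3P; split.
- apply/eqP=> /setP/(_ c); rewrite !inE eqxx ?orbT /= !(eq_sym c).
  by rewrite (negbTE ac) (negbTE bc) (negbTE dc).
- apply/eqP=> /setP/(_ b); rewrite !inE eqxx ?orbT /= (eq_sym b a).
  by rewrite (negbTE ab) (negbTE bc) (eq_sym b) (negbTE eb).
apply/eqP=> /setP/(_ b); rewrite !inE eqxx ?orbT /= (eq_sym b a).
by rewrite (negbTE ab) (negbTE bc) (eq_sym b) (negbTE eb).
Qed.

(** With [u] and [w] both completing [ab] to a triple, a triple through [uw]
    would close a Berge triangle on [a], [u] and [w]. *)
Lemma codegree_set_independent (V : finType) (E : {set {set V}}) (a b u w z : V) :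
  {in E, forall T : {set V}, #|T| = 3} -> ~ berge_cycle E 3 ->
  link E a b u -> link E a b w -> u != w -> link E u w z -> False.
Proof.
move=> card3 tri abu abw uw uwz; apply: tri.
have [ab au bu] := triple_uniq (card3 _ abu).
have [_ aw bw] := triple_uniq (card3 _ abw).
apply: (berge_triangle (a := a) (b := u) (c := w) _ _ abu uwz abw);
  rewrite ?inE ?eqxx ?orbT //.
  by rewrite /= !inE negb_or au aw uw.
rewrite /= !inE negb_or andbT -andbA; apply/and3P; split.
- apply/eqP=> /setP/(_ w); rewrite !inE eqxx ?orbT /= !(eq_sym w).
  by rewrite (negbTE aw) (negbTE bw) (negbTE uw).
- apply/eqP=> /setP/(_ w); rewrite !inE eqxx ?orbT /= !(eq_sym w).
  by rewrite (negbTE aw) (negbTE bw) (negbTE uw).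
apply/eqP=> /setP/(_ u); rewrite !inE eqxx ?orbT /= !(eq_sym u).
by rewrite (negbTE au) (negbTE bu) eq_sym (negbTE uw).
Qed.

Lemma link_star_forest (V : finType) (E : {set {set V}}) (x : V) :
  {in E, forall T : {set V}, #|T| = 3} -> ~ berge_cycle E 3 ->
  star_forest (link E x).
Proof.
move=> card3 tri a b c d ab ac bc bd; apply/eqP; apply: contraT => da.
have := one_heavy_pair card3 tri ab ac bd; rewrite eq_sym => /(_ bc da); by [].
Qed.

(** Otherwise every vertex lies in a pair contained in about half of the
    possible triples, or more. Take such a pair [ab], and let [L] be the set
    of the third vertices. For [u] in [L] a heavy pair [uc] has [c] and all its
    third vertices outside [L], [a] and [b], so these vertices must fill all
    the remaining space [R]. This happens for two different vertices [u] and [u']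
    of [L], and the triples so obtained contain a Berge triangle. *)
Lemma small_codegree_vertex (V : finType) (E : {set {set V}}) (S : {set V}) :
  {in E, forall T : {set V}, #|T| = 3} -> ~ berge_cycle E 3 -> 6 < #|S| ->
  exists2 x, x \in S & {in S, forall c, 2 * #|nbrs S (link E x) c| + 4 <= #|S|}.
Proof.
move=> card3 tri S6.
pose low x := [forall c in S, 2 * #|nbrs S (link E x) c| + 4 <= #|S|].
have [/existsP[x /andP[xS /'forall_implyP low_x]]|none] :=
    boolP [exists x in S, low x].
  by exists x.
have heavy x : x \in S ->
    exists2 c, c \in S & #|S| < 2 * #|nbrs S (link E x) c| + 4.
  move=> xS; move: none => /existsPn/(_ x); rewrite xS /= negb_forall.
  by case/existsP=> c; rewrite negb_imply -ltnNge => /andP[cS ?]; exists c.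
have hv := one_heavy_pair card3 tri.
have t12 := link_rot E; have t23 : forall a b c, link E a b c = link E a c b.
  by move=> a b c; apply: link_sym.
have [a aS] : exists a, a \in S by apply/card_gt0P; move: S6; clear; lia.
have [b bS lam] := heavy a aS.
set L := nbrs S (link E a) b in lam.
have memL v : v \in L -> v \in S /\ link E a b v by rewrite inE => /andP.
have aL : a \notin L.
  apply/negP=> /memL[_ ta]; have [_ aa _] := triple_uniq (card3 _ ta).
  by rewrite eqxx in aa.
have bL : b \notin L.
  apply/negP=> /memL[_ tb]; have [_ _ bb] := triple_uniq (card3 _ tb).
  by rewrite eqxx in bb.
have ab : a != b.
  have /card_gt0P[v /memL[_ tv]] : 0 < #|L| by move: lam S6; clear; lia.
  by have [] := triple_uniq (card3 _ tv).
pose R := S :\: (L :|: [set a; b]).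
have cardR : #|R| + #|L| + 2 = #|S|.
  have dLab : [disjoint L & [set a; b]].
    rewrite disjoint_sym disjoints_subset.
    by apply/subsetP=> v /set2P[]->; rewrite inE.
  have sub : L :|: [set a; b] \subset S.
    by apply/subsetP=> v; rewrite !inE => /orP[/andP[]|/orP[]/eqP->].
  rewrite -(cardsID (L :|: [set a; b]) S) (setIidPr sub) -/R.
  by rewrite cardsU cards2 ab disjoint_setI0 // cards0; clear; lia.
(* The heavy partner of an element of [L] and the third vertices of the pair
   fill [R]. *)
have branch v v' : v \in L -> v' \in L -> v != v' -> exists c,
    [/\ 1 < #|nbrs S (link E v) c|, c \notin nbrs S (link E v) c
      & c |: nbrs S (link E v) c = R].
  move=> vL v'L vv'; have [vS tv] := memL v vL; have [_ tv'] := memL v' v'L.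
  have v'v : v' != v by rewrite eq_sym.
  have [c cS heavy_c] := heavy v vS; exists c.
  set M := nbrs S (link E v) c in heavy_c *.
  have M1 : 1 < #|M| by clear -heavy_c S6; lia.
  have memM w : w \in M -> w \in S /\ link E v c w by rewrite inE => /andP.
  have cM : c \notin M.
    apply/negP=> /memM[_ tc]; have [_ _ cc] := triple_uniq (card3 _ tc).
    by rewrite eqxx in cc.
  have ca : c != a.
    apply/eqP=> ca; have [z /memM[_ vcz] zb] := another_member b M1.
    apply: (hv a b v v' z) => //; by rewrite t12 -ca.
  have cb : c != b.
    apply/eqP=> cb; have [z /memM[_ vcz] za] := another_member a M1.
    apply: (hv b a v v' z) => //; by rewrite t12 // -cb.
  have cL : c \notin L.
    apply/negP=> /memL[_ tc]; have [z /memM[_ vcz] _] := another_member a M1.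
    have [vc _ _] := triple_uniq (card3 _ vcz).
    exact: (codegree_set_independent card3 tri tv tc vc vcz).
  have subR : c |: M \subset R.
    apply/subsetP=> w; rewrite in_setU1 in_setD in_setU in_set2.
    case/orP=> [/eqP->|wM]; first by rewrite cS negb_or cL negb_or ca cb.
    have [-> vcw] := memM w wM; have [_ vw _] := triple_uniq (card3 _ vcw).
    rewrite andbT; apply/negP; case/orP=> [/memL[_ tw]|/orP[]/eqP E'].
    - apply: (codegree_set_independent card3 tri tv tw vw (z := c)).
      by rewrite t23.
    - by apply: (hv a b v v' c) => //; rewrite -E' t12 t23.
    by apply: (hv b a v v' c) => //; [rewrite t12|rewrite t12|rewrite -E' t12 t23].
  split=> //; apply/eqP; rewrite eqEcard subR cardsU1 cM.
  by clear -heavy_c lam cardR; lia.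
have /card_gt1P[u [u' [uL u'L uu']]] : 1 < #|L| by clear -lam S6; lia.
have u'u : u' != u by rewrite eq_sym.
have [c [M1 cM cMR]] := branch u u' uL u'L uu'.
have [c' [M'1 cM' cMR']] := branch u' u u'L uL u'u.
set M := nbrs S (link E u) c in M1 cM cMR.
set M' := nbrs S (link E u') c' in M'1 cM' cMR'.
have memM w : w \in M -> link E c u w by rewrite inE t12 => /andP[].
have memM' w : w \in M' -> link E c' u' w by rewrite inE t12 => /andP[].
have [cc'|cc'] := eqVneq c c'.
  have /card_gt1P[w1 [w2 [w1M w2M w12]]] := M1.
  have w1M' : w1 \in M'.
    have : w1 \in R by rewrite -cMR in_setU1 w1M orbT.
    rewrite -cMR' in_setU1 -cc' => /orP[/eqP w1c|//].
    by rewrite -w1c w1M in cM.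
  case: (hv c w1 u u' w2) => //.
  - by rewrite t23 memM.
  - by rewrite t23 cc' memM'.
  - exact: memM.
  - by rewrite eq_sym.
have c'M : c' \in M.
  have : c' \in R by rewrite -cMR' setU11.
  by rewrite -cMR in_setU1 eq_sym (negbTE cc').
have cM'' : c \in M'.
  have : c \in R by rewrite -cMR setU11.
  by rewrite -cMR' in_setU1 (negbTE cc').
have [z zM zc'] := another_member c' M1.
case: (hv c c' u u' z) => //.
- by rewrite t23 memM.
- by rewrite t12 t23 memM'.
exact: memM.
Qed.

(** * Extending a Berge cycle by one vertex *)

Lemma incident_cycle_mem (V : finType) (s : seq (V * {set V})) p :
  cycle (@incident V) s -> p \in s -> p.1 \in p.2.
Proof. by move=> cyc /(next_cycle cyc)/andP[]. Qed.

(** The vertex [x] is inserted after [v]: the two triples replace the hyperedge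
    that led from [v] to the next vertex, and are new because the old
    hyperedges avoid [x]. *)
Lemma berge_cycle_insert (V : finType) (R : {set {set V}}) (x v w w' : V)
    (s : seq (V * {set V})) :
  cycle (@incident V) s -> uniq (unzip1 s) -> uniq (unzip2 s) ->
  {subset unzip2 s <= R} -> (forall T, T \in unzip2 s -> x \notin T) ->
  1 < size s -> v \in unzip1 s ->
  link R x v w -> link R x (next (unzip1 s) v) w' ->
  [set x; v; w] != [set x; next (unzip1 s) v; w'] ->
  berge_cycle R (size s).+1.
Proof.
move=> cyc uq1 uq2 sR xs s1 /mapP[[v1 h] vhs /= ->] {v}.
have [i s' rot_s] := rot_to vhs.
have sz : size s = (size s').+1 by rewrite -(size_rot i) rot_s.
have -> : next (unzip1 s) v1 = next (unzip1 (rot i s)) v1.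
  by rewrite /unzip1 map_rot next_rot.
have sub2 : {subset unzip2 (rot i s) <= unzip2 s}.
  by move=> T; rewrite /unzip2 map_rot mem_rot.
have {}cyc : cycle (@incident V) (rot i s) by rewrite rot_cycle.
have {}uq1 : uniq (unzip1 (rot i s)) by rewrite /unzip1 map_rot rot_uniq.
have {}uq2 : uniq (unzip2 (rot i s)) by rewrite /unzip2 map_rot rot_uniq.
have x1 : x \notin unzip1 (rot i s).
  apply/mapP=> -[[u T] uT /= xu].
  have := incident_cycle_mem cyc uT; rewrite /= -xu.
  by apply/negP/xs/sub2; apply/mapP; exists (u, T).
move: sub2 cyc uq1 uq2 x1; rewrite rot_s.
case: s' sz {rot_s} => [|[v2 h2] s'] sz; first by rewrite sz in s1.
rewrite /= eqxx => sub2 /andP[_ cyc2] uq1 uq2 x1 t t' tt'.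
set T := [set x; v1; w] in t tt' *; set T' := [set x; v2; w'] in t' tt' *.
have notin (U : {set V}) : x \in U -> U \notin unzip2 ((v1, h) :: (v2, h2) :: s').
  by apply: contraTN => Us; apply: xs; apply: sub2.
have xT : x \in T by rewrite !inE eqxx.
have xT' : x \in T' by rewrite !inE eqxx.
exists ((v1, T) :: (x, T') :: (v2, h2) :: s'); split.
- by rewrite sz.
- rewrite /= {1 2}/incident /= xT xT' /T /T' !inE !eqxx !orbT /=.
  by move: cyc2; rewrite !rcons_path.
- move: uq1 x1; rewrite /= !inE !negb_or => /andP[/andP[v12 v1s] /andP[v2s ->]].
  case/and3P=> xv1 xv2 xs'.
  by rewrite eq_sym xv1 v12 v1s xv2 xs' v2s.
- move: uq2 (notin T xT) (notin T' xT'); rewrite /= !inE !negb_or.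
  move=> /and3P[_ -> ->] /and3P[_ -> ->] /and3P[_ -> ->].
  by rewrite tt'.
move=> Q; rewrite !inE => /or3P[/eqP->|/eqP->|Qs] //.
apply: sR; apply: sub2; rewrite inE; apply/orP; right; exact: Qs.
Qed.

(** Let [C] be the cycle, on all but one of the vertices of [W = S - x]. Either
    two red link edges at consecutive vertices allow [x] to be inserted in
    [C], or the red link is so restricted that the blue link of [x] carries a
    Berge cycle through [x] and all but one of the vertices of [W]. *)
Lemma extend_or_switch (V : finType) (R B G R0 : {set {set V}}) (S : {set V})
    (x : V) (m : nat) :
  {in B, forall T : {set V}, #|T| = 3} ->
  {in G, forall T : {set V}, #|T| = 3} ->
  (forall a b, a \in S :\ x -> b \in S :\ x -> a != b ->
     [|| link R x a b, link G x a b | link B x a b]) ->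
  R0 \subset R -> {in R0, forall T : {set V}, T \subset S :\ x} ->
  x \in S -> #|S| = m.+2 -> 4 < m ->
  ~ berge_cycle G 3 ->
  {in S, forall c, 2 * #|nbrs S (link G x) c| + 4 <= #|S|} ->
  berge_cycle R0 m -> berge_cycle R m.+1 \/ berge_cycle B m.+1.
Proof.
move=> cardB cardG cover subR R0W xS cardS m5 triG degG.
case=> s [sz cyc uq1 uq2 sR0].
set vs := unzip1 s in uq1.
have szvs : size vs = m by rewrite size_map.
pose W := S :\ x.
have xW : x \notin W by rewrite !inE eqxx.
have cardW : #|W| = m.+1 by move: cardS; rewrite (cardsD1 x) xS => -[].
have vsW v : v \in vs -> v \in W.
  case/mapP=> -[u T] uT ->; apply: (subsetP (R0W T _)).
    by apply: sR0; apply/mapP; exists (u, T).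
  exact: incident_cycle_mem cyc uT.
pose extendable v w w' := [&& v \in vs, link R x v w, link R x (next vs v) w'
  & [set x; v; w] != [set x; next vs v; w']].
have [/existsP[v /existsP[w /existsP[w' /and4P[vvs vw nw ne]]]]|none] :=
    boolP [exists v, exists w, exists w', extendable v w w'].
  left; rewrite -sz; apply: berge_cycle_insert vvs vw nw ne => //.
  - by move=> T /sR0; apply: (subsetP subR).
  - by move=> T /sR0/R0W/subsetP sT; apply: contraNN xW; apply: sT.
  - by rewrite sz; move: m5; clear; lia.
right.
have next_neq v : v \in vs -> next vs v != v.
  by apply: next_neq => //; rewrite szvs; move: m5; clear; lia.
(* As [x] cannot be inserted, two red link edges at consecutive vertices of [C]
   coincide, so they join these two vertices. *)
have forced v w w' : v \in vs -> link R x v w -> link R x (next vs v) w' ->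
    w = next vs v /\ w' = v.
  move=> vvs vw nw.
  have : [set x; v; w] = [set x; next vs v; w'].
    apply/eqP; apply: contraR none => ne; apply/existsP; exists v.
    by apply/existsP; exists w; apply/existsP; exists w'; apply/and4P.
  move=> /setP E.
  have vx : v != x by apply: contraTneq (vsW v vvs) => ->.
  have nx : next vs v != x.
    have : next vs v \in vs by rewrite mem_next.
    by move/vsW; apply: contraTneq => ->.
  move: (E (next vs v)) (E v); rewrite !inE !eqxx !orbT (negbTE vx) (negbTE nx).
  rewrite /= (negbTE (next_neq v vvs)) (eq_sym v) (negbTE (next_neq v vvs)) /=.
  by move=> /eqP-> /esym/eqP->.
(* [U] consists of the vertices of [C] with red neighbours that do not belong
   to an isolated red pair of consecutive vertices; [I] is [U] together with
   the vertex of [W] off the cycle. *)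
pose C := [set v | v \in vs].
have cardC : #|C| = m by rewrite cardsE (card_uniqP uq1).
pose U := [set v in C | [&& [exists w, link R x v w], ~~ link R x v (next vs v)
  & ~~ link R x v (prev vs v)]].
pose D := C :\: U; pose I := W :\: D.
have DC : D \subset C by apply: subsetDl.
have CW : C \subset W by apply/subsetP=> v; rewrite inE; apply: vsW.
have DW : D \subset W by apply: subset_trans DC CW.
have IDW : I :|: D = W.
  by rewrite /I setDE setUIl setUC (setUidPr DW) [~: D :|: D]setUC setUCr setIT.
have mate d w : d \in D -> link R x d w ->
    w \in D /\ forall w', link R x d w' -> w' = w.
  rewrite !inE negb_and => /andP[+ dvs] dw; rewrite dvs /=.
  have -> : [exists w, link R x d w] by apply/existsP; exists w.
  rewrite /= -negb_or negbK => /orP[dn|dp].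
    have nd : link R x (next vs d) d by rewrite link_sym.
    have uw w' : link R x d w' -> w' = next vs d.
      by move=> dw'; have [] := forced d w' d dvs dw' nd.
    rewrite (uw w dw); split=> //; rewrite mem_next dvs andbT /= prev_next // nd.
    by rewrite !andbF.
  have pvs : prev vs d \in vs by rewrite mem_prev.
  have pd : link R x (prev vs d) d by rewrite link_sym.
  have npd := next_prev uq1 d.
  have uw w' : link R x d w' -> w' = prev vs d.
    move=> dw'; have := forced (prev vs d) d w' pvs pd; rewrite npd.
    by case/(_ dw').
  rewrite (uw w dw); split=> //; rewrite pvs andbT /= npd pd.
  by rewrite !andbF.
(* No two consecutive vertices are in [U]. *)
have leUD : #|U| <= #|D|.
  have inj_next : {in U &, injective (next vs)}.
    by move=> a b _ _; apply: (can_inj (prev_next uq1)).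
  rewrite -(card_in_imset inj_next).
  apply/subset_leq_card/subsetP=> _ /imsetP[v vU ->].
  move: vU; rewrite !inE mem_next => /and4P[vvs /existsP[w vw] nvn _].
  rewrite vvs andbT /=; apply/negP=> /and3P[/existsP[w' nw'] _ _].
  have [Ew _] := forced v w w' vvs vw nw'.
  by rewrite -Ew vw in nvn.
have UC : U \subset C by apply/subsetP=> v; rewrite inE => /andP[].
have cardUD : #|U| + #|D| = m by rewrite -cardC -(cardsID U C) (setIidPr UC).
have cardID : #|I| + #|D| = m.+1.
  by rewrite -cardW -(cardsID D W) (setIidPr DW) addnC.
have disID : [disjoint I & D] by rewrite disjoints_subset subsetDr.
have D3 : 2 < #|D| by clear -leUD cardUD m5; lia.
have [i0 i0I] : exists i, i \in I.
  by apply/card_gt0P; clear -leUD cardUD cardID; lia.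
(* Among the vertices of [I], the one with most green neighbours in [D] is left
   out: the green stars being disjoint, every other vertex of [I] keeps at
   least half of [D] as blue neighbours. *)
have [w0 w0I max_w0] := arg_maxnP (fun i => #|nbrs D (link G x) i|) i0I.
have {}w0I : w0 \in I := w0I.
have notx a : a \in W -> a != x by apply: contraTneq => ->.
have starG := link_star_forest (x := x) cardG triG.
have gW a : a \in W -> 2 * #|nbrs W (link G x) a| + 2 <= m.
  move=> aW; have aS : a \in S by move: aW; rewrite inE => /andP[].
  have sub : nbrs W (link G x) a \subset nbrs S (link G x) a.
    by apply/subsetP=> b; rewrite !inE => /andP[/andP[_ ->] ->].
  have := subset_leq_card sub; have := degG a aS; rewrite cardS.
  by clear; lia.
have cross i d : i \in I -> d \in D -> link B x d i || link G x d i.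
  move=> iI dD.
  have iD : i \notin D by move: iI; rewrite inE => /andP[].
  have di : d != i by apply: contraNneq iD => <-.
  have iW : i \in W by move: iI; rewrite inE => /andP[].
  have := cover d i (subsetP DW d dD) iW di.
  by case/or3P=> [/(mate d i dD)[]|->|->]; rewrite ?orbT // (negbTE iD).
have inD a b : a \in D -> b \in D -> a != b ->
    [|| link B x a b, link G x a b | link R x a b].
  move=> aD bD ab; have := cover a b (subsetP DW a aD) (subsetP DW b bD) ab.
  by case/or3P=> ->; rewrite ?orbT.
have red1 d : d \in D -> #|nbrs D (link R x) d| <= 1.
  move=> dD; rewrite leqNgt; apply/negP=> /card_gt1P[a [b []]].
  rewrite !inE => /andP[_ da] /andP[_ db].
  have [_ uw] := mate d a dD da; by rewrite (uw b db) eqxx.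
pose W' := I :\ w0 :|: D.
have W'W : W' \subset W.
  by rewrite -IDW; apply: setSU; apply: subsetDl.
have cardW' : #|W'| = m.
  rewrite /W' cardsU disjoint_setI0 ?cards0; last first.
    by apply: disjointWl disID; apply: subsetDl.
  by move: cardID; rewrite (cardsD1 w0 I) w0I subn0; clear; lia.
have ham : hamiltonian (x |: W') (fun a b => [|| a == x, b == x | link B x a b]).
  apply: (split_graph_hamiltonian (green := link G x) (red := link R x) m5) => //.
  - by apply: contraNN xW; rewrite inE => /andP[].
  - by apply: contraNN xW; apply: (subsetP DW).
  - by move: leUD cardUD cardID; clear; lia.
  - exact: link_sym.
  - exact: link_sym.
  by move=> a; rewrite IDW; apply: gW.
have degD d : d \in D -> 2 < #|nbrs W (link B x) d|.
  move=> dD; have dW := subsetP DW d dD.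
  have sub : W :\ d \subset nbrs W (link B x) d :|: nbrs W (link G x) d
                          :|: nbrs D (link R x) d.
    apply/subsetP=> b; rewrite in_setD1 => /andP[bd bW].
    rewrite !in_setU ![_ \in nbrs _ _ _]inE bW /=.
    have := cover d b dW bW; rewrite eq_sym bd => /(_ isT) /or3P[rb|->|->];
      rewrite ?orbT //.
    by have [-> _] := mate d b dD rb; rewrite rb !orbT.
  have := subset_leq_card sub; have := gW d dW; have := red1 d dD.
  have := leq_of_leqif (leq_card_setU
    (nbrs W (link B x) d :|: nbrs W (link G x) d) (nbrs D (link R x) d)).
  have := leq_of_leqif (leq_card_setU
    (nbrs W (link B x) d) (nbrs W (link G x) d)).
  move: cardW; rewrite (cardsD1 d W) dW.
  by clear -m5; lia.
have [d dD] : exists d, d \in D by apply/card_gt0P; apply: leq_trans D3.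
rewrite -cardW'.
apply: (link_hamiltonian_berge_cycle cardB W'W xW _ _ _ _ ham (d := d)).
- by rewrite cardW'; clear -m5; lia.
- move=> w /setUP[wI|/degD]; last exact: ltnW.
  have [ww0 {}wI] := setD1P wI.
  have sub : D :\: nbrs D (link G x) w \subset nbrs W (link B x) w.
    apply/subsetP=> b; rewrite in_setD => /andP[+ bD].
    rewrite ![_ \in nbrs _ _ _]inE bD (subsetP DW b bD) /= => nwb.
    move: (cross w b wI bD).
    by rewrite ![link _ x b w]link_sym (negbTE nwb) orbF.
  apply: leq_trans (subset_leq_card sub).
  rewrite cardsD (setIidPr _); last by apply/subsetP=> b; rewrite inE => /andP[].
  have [le1|gt1] := leqP #|nbrs D (link G x) w| 1; first by clear -le1 D3; lia.
  have dis : [disjoint nbrs D (link G x) w & nbrs D (link G x) w0].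
    rewrite -setI_eq0; apply/eqP/setP=> b; rewrite !inE; apply/negP.
    case/andP=> /andP[_ wb] /andP[_ w0b].
    have [c] := another_member b gt1; rewrite inE => /andP[_ wc] cb.
    have E : w0 = w by apply: (starG w b c w0); rewrite 1?eq_sym // link_sym.
    by rewrite E eqxx in ww0.
  have := max_w0 w wI; move: dis; rewrite -(leq_card_setU _ _) => /eqP dis.
  have sub2 : nbrs D (link G x) w :|: nbrs D (link G x) w0 \subset D.
    by apply/subsetP=> b; rewrite !inE => /orP[]/andP[].
  have := subset_leq_card sub2; rewrite dis; clear -D3; lia.
- by rewrite inE dD orbT.
exact: degD.
Qed.

(** * Exhaustive search on five and six vertices *)

(** [has] with explicit branching, so that call-by-value evaluation stops at the
    first success. The conditionals in the functions below serve the same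
    purpose. *)
Fixpoint some (T : Type) (a : T -> bool) (s : seq T) : bool :=
  if s is x :: s' then if a x then true else some a s' else false.

Lemma someE (T : Type) (a : T -> bool) (s : seq T) : some a s = has a s.
Proof. by elim: s => //= x s <-; case: (a x). Qed.

(** Searches for a Berge path from [v] to [v0] with [l] inner vertices outside
    [visited], using distinct hyperedges of [ts]. *)
Fixpoint closes_up (l v0 v : nat) (visited : seq nat) (ts : seq (seq nat)) :
    bool :=
  if l is l'.+1 then
    some (fun t : seq nat =>
      if v \in t then
        some (fun w => if w \in visited then false
                       else closes_up l' v0 w (w :: visited) (rem t ts)) t
      else false) ts
  else some (fun t : seq nat => (v \in t) && (v0 \in t)) ts.

(** Berge cycles of length [l + 2] that use [t] and hyperedges of [ts]. A cycle
    may be read in both directions, so [a < b] can be assumed. *)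
Definition cycle_through (l : nat) (t : seq nat) (ts : seq (seq nat)) : bool :=
  some (fun a => some (fun b => if a < b then closes_up l a b [:: a; b] ts
                                else false) t) t.

(** Whether all ways to add [k] elements of [todo] to [chosen] create a Berge
    cycle of length [l + 2]; only cycles through the newest triple are looked
    for, and a branch is cut as soon as one appears. *)
Fixpoint unavoidable (l : nat) (chosen todo : seq (seq nat)) (k : nat) : bool :=
  if todo is t :: todo' then
    if size todo < k then true
    else if (if cycle_through l t chosen then true
             else unavoidable l (t :: chosen) todo' k.-1)
         then unavoidable l chosen todo' k else false
  else 0 < k.

(** Triples are sorted, so that each one has a single code. *)
Definition triples (n : nat) : seq (seq nat) :=
  [seq t <- [seq i :: p | i <- iota 0 n,
       p <- [seq [:: j; k] | j <- iota 0 n, k <- iota 0 n]] | sorted ltn t].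

Definition code_incident : rel (nat * seq nat) :=
  fun p q => (p.1 \in p.2) && (q.1 \in p.2).

Lemma closes_upP (l v0 v : nat) (visited : seq nat) (ts : seq (seq nat)) :
  uniq ts -> closes_up l v0 v visited ts ->
  exists T s, [/\ size s = l, path code_incident (v, T) (rcons s (v0, [::])),
    uniq (unzip1 s), {in unzip1 s, forall w, w \notin visited}
    & uniq (T :: unzip2 s) /\ {subset T :: unzip2 s <= ts}].
Proof.
elim: l v visited ts => [|l IH] v visited ts uq_ts /=; rewrite someE.
  case/hasP=> T Tts /andP[vT v0T]; exists T, [::]; split=> //=.
    by rewrite /code_incident /= vT v0T.
  by split=> // T'; rewrite inE => /eqP->.
case/hasP=> T Tts; case: ifP => // vT; rewrite someE => /hasP[w wT].
case: ifPn => // wvis /(IH _ _ _ (rem_uniq _ uq_ts)).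
case=> T' [s [sz pth uq1 new [uq2 sub]]].
have sub' U : U \in T' :: unzip2 s -> U != T /\ U \in ts.
  by move/sub; rewrite mem_rem_uniq // inE => /andP.
exists T, ((w, T') :: s); split.
- by rewrite /= sz.
- by rewrite /= {1}/code_incident /= vT wT.
- by rewrite /= uq1 andbT; apply/negP=> /new; rewrite inE eqxx.
- by move=> u /=; rewrite inE => /orP[/eqP->//|/new]; rewrite inE negb_or => /andP[].
rewrite -[unzip2 (_ :: s)]/(T' :: unzip2 s).
split; first by apply/andP; split; [apply/negP=> /sub'[]; rewrite eqxx|].
by move=> U; rewrite inE => /orP[/eqP->//|/sub'[]].
Qed.

Definition code_cycle (l : nat) (ts : seq (seq nat)) : Prop :=
  exists s, [/\ size s = l, cycle code_incident s, uniq (unzip1 s),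
    uniq (unzip2 s) & {subset unzip2 s <= ts}].

Lemma cycle_throughP (l : nat) (t : seq nat) (ts : seq (seq nat)) :
  uniq (t :: ts) -> cycle_through l t ts -> code_cycle l.+2 (t :: ts).
Proof.
case/andP=> tts uq_ts; rewrite /cycle_through someE => /hasP[a at_].
rewrite someE => /hasP[b bt]; case: ifP => // ab.
case/(closes_upP uq_ts) => T [s [sz pth uq1 new [uq2 sub]]].
exists ((a, t) :: (b, T) :: s); split.
- by rewrite /= sz.
- move: pth; rewrite /= !rcons_path => /andP[pth lst].
  by rewrite {1}/code_incident /= at_ bt pth.
- rewrite /= uq1 inE negb_or (ltn_eqF ab) /= andbT.
  by apply/andP; split; apply/negP=> /new; rewrite !inE eqxx ?orbT.
- rewrite -[unzip2 _]/(t :: T :: unzip2 s) cons_uniq.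
  by apply/andP; split; first by apply: contra tts => /sub.
by move=> U; rewrite inE => /orP[/eqP->|/sub Uts]; rewrite inE ?eqxx ?Uts ?orbT.
Qed.

Lemma unavoidableP (p : pred (seq nat)) (l : nat) (chosen todo : seq (seq nat))
    (k : nat) :
  uniq (chosen ++ todo) -> all p chosen -> k <= count p todo ->
  unavoidable l chosen todo k ->
  exists2 ts, code_cycle l.+2 ts & {subset ts <= filter p (chosen ++ todo)}.
Proof.
elim: todo chosen k => [|t todo IH] chosen k uq pc /=; first by case: k.
have perm_t : perm_eq (chosen ++ t :: todo) (t :: chosen ++ todo).
  by rewrite perm_sym -cat_rcons -cat_cons perm_cat2r perm_sym perm_rcons.
move: (uq); rewrite (perm_uniq perm_t) => uq'.
have skip : k <= count p todo -> unavoidable l chosen todo k ->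
    exists2 ts, code_cycle l.+2 ts &
      {subset ts <= filter p (chosen ++ t :: todo)}.
  have /andP[_ uq''] := uq'; move=> le_k /(IH chosen k uq'' pc le_k)[ts cyc sub].
  exists ts => // U /sub; rewrite !mem_filter (perm_mem perm_t) inE.
  by case/andP=> -> ->; rewrite orbT.
case: ifP => [lt_k|_].
  by have := count_size p todo; case: (p t) lt_k => /=; clear; lia.
case pt: (p t) => /= le_k; last by case: ifP => // _; apply: skip.
case: ifP => // take_t _; move: take_t.
case: ifP => [cyc _|_].
  exists (t :: chosen).
    by apply: cycle_throughP cyc; move: uq'; rewrite -cat_cons cat_uniq => /and3P[].
  move=> U; rewrite inE mem_filter (perm_mem perm_t) inE mem_cat.
  by case/orP=> [/eqP->|Uc]; rewrite ?pt ?eqxx // (allP pc) // Uc /= orbT.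
have le_k' : k.-1 <= count p todo by move: le_k; clear; lia.
have pc' : all p (t :: chosen) by rewrite /= pt.
case/(IH (t :: chosen) k.-1 uq' pc' le_k') => ts cyc sub; exists ts => // U /sub.
by rewrite !mem_filter (perm_mem perm_t) -cat_cons.
Qed.

Lemma mem_triples (n : nat) (t : seq nat) : t \in triples n ->
  [/\ size t = 3, sorted ltn t & all (fun i => i < n) t].
Proof.
rewrite mem_filter => /andP[st /allpairsP[[i p] /= [+ + E]]].
rewrite mem_iota => /andP[_ lti] /allpairsP[[j k] /= []].
rewrite !mem_iota => /andP[_ ltj] /andP[_ ltk] Ep.
rewrite !add0n in lti ltj ltk; rewrite E Ep in st *; split=> //=.
by rewrite lti ltj ltk.
Qed.

Definition decode (V : finType) (f : nat -> V) (t : seq nat) : {set V} :=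
  [set v in map f t].

Lemma mem_decode (V : finType) (f : nat -> V) (n i : nat) (t : seq nat) :
  {in [pred i | i < n] &, injective f} -> t \in triples n -> i < n ->
  (f i \in decode f t) = (i \in t).
Proof.
move=> injf /mem_triples[_ _ /allP ltn_t] ltin; rewrite inE.
apply/mapP/idP=> [[j jt fij]|it]; last by exists i.
by rewrite (injf i j ltin (ltn_t j jt) fij).
Qed.

Lemma decode_inj (V : finType) (f : nat -> V) (n : nat) :
  {in [pred i | i < n] &, injective f} -> {in triples n &, injective (decode f)}.
Proof.
move=> injf t t' tn tn' E.
have [_ st lt_t] := mem_triples tn; have [_ st' lt_t'] := mem_triples tn'.
apply: (irr_sorted_eq ltn_trans ltnn st st') => i.
have [lti|gei] := ltnP i n.
  by rewrite -(mem_decode injf tn) // -(mem_decode injf tn') // E.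
have out u : all (fun i => i < n) u -> i \in u = false.
  by move/allP=> lt_u; apply/negP=> /lt_u; rewrite ltnNge gei.
by rewrite !out.
Qed.

Lemma decode_berge_cycle (V : finType) (E : {set {set V}}) (f : nat -> V)
    (n l k : nat) :
  {in [pred i | i < n] &, injective f} -> uniq (triples n) ->
  unavoidable l [::] (triples n) k ->
  k <= count (fun t => decode f t \in E) (triples n) -> berge_cycle E l.+2.
Proof.
move=> injf uq unav le_k.
have [] := @unavoidableP (fun t => decode f t \in E) l [::] _ k uq isT le_k unav.
rewrite cat0s => ts [s [sz cyc uq1 uq2 sub1]] sub2.
have sub T : T \in unzip2 s -> T \in triples n /\ decode f T \in E.
  by move/sub1/sub2; rewrite mem_filter => /andP[].
have inc p : p \in s -> p.1 \in p.2 by move=> /(next_cycle cyc)/andP[].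
have lt1 i : i \in unzip1 s -> i < n.
  case/mapP=> -[j T] jT -> /=.
  have /sub[/mem_triples[_ _ /allP lt_T] _] : T \in unzip2 s.
    by apply/mapP; exists (j, T).
  by apply: lt_T; apply: inc jT.
pose g (p : nat * seq nat) := (f p.1, decode f p.2).
have u1 : unzip1 (map g s) = map f (unzip1 s) by rewrite /unzip1 -!map_comp.
have u2 : unzip2 (map g s) = map (decode f) (unzip2 s) by rewrite /unzip2 -!map_comp.
exists (map g s); split.
- by rewrite size_map.
- apply: homo_cycle cyc => p q /andP[p1 q1].
  by rewrite /incident /= !inE !map_f.
- rewrite u1 map_inj_in_uniq // => i j /lt1 lti /lt1 ltj; exact: injf.
- rewrite u2 map_inj_in_uniq // => T T' /sub[Tn _] /sub[T'n _].
  exact: decode_inj injf _ _ Tn T'n.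
by move=> T; rewrite u2 => /mapP[T' /sub[_ E'] ->].
Qed.

Lemma majority (T : eqType) (p q r : pred T) (s : seq T) (k : nat) :
  {in s, forall x, [|| p x, q x | r x]} -> 3 * k < size s ->
  [|| k < count p s, k < count q s | k < count r s].
Proof.
move=> cover; have : size s <= count p s + count q s + count r s.
  elim: s cover => //= x s IH cover; have := cover x (mem_head x s).
  have {IH} := IH (fun y ys => cover y (mem_behead (s := x :: s) ys)).
  by case: (p x) (q x) (r x) => [] [] [] //=; clear; lia.
by clear; lia.
Qed.

Lemma four_triples_on_five : unavoidable 1 [::] (triples 5) 4
  /\ unavoidable 2 [::] (triples 5) 4.
Proof. by split; vm_compute. Qed.

Lemma seven_triples_on_six : unavoidable 1 [::] (triples 6) 7
  /\ unavoidable 3 [::] (triples 6) 7.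
Proof. by split; vm_compute. Qed.

(** * The upper bound *)

Definition color_class (V : finType) (K : eqType) (c : {set V} -> K) (S : {set V})
    (i : K) : {set {set V}} :=
  [set T : {set V} | [&& T \subset S, #|T| == 3 & c T == i]].

Lemma color_class_card (V : finType) (K : eqType) (c : {set V} -> K) (S : {set V})
    (i : K) : {in color_class c S i, forall T : {set V}, #|T| = 3}.
Proof. by move=> T; rewrite inE => /and3P[_ /eqP]. Qed.

Lemma color_class_sub (V : finType) (K : eqType) (c : {set V} -> K)
    (S S' : {set V}) (i : K) :
  S' \subset S -> color_class c S' i \subset color_class c S i.
Proof.
move=> sS'; apply/subsetP=> T; rewrite !inE => /and3P[sT -> ->].
by rewrite (subset_trans sT sS').
Qed.

Lemma berge_cycle_sub (V : finType) (E E' : {set {set V}}) (l : nat) :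
  E \subset E' -> berge_cycle E l -> berge_cycle E' l.
Proof.
move=> sub [s [sz cyc uq1 uq2 sE]]; exists s; split=> // T /sE.
exact: (subsetP sub).
Qed.

Lemma berge_cycle_decidable (V : finType) (E : {set {set V}}) (l : nat) :
  decidable (berge_cycle E l).
Proof.
pose P (s : l.-tuple (V * {set V})) := [&& cycle (@incident V) s,
  uniq (unzip1 s), uniq (unzip2 s) & all (mem E) (unzip2 s)].
have [ex|none] := boolP [exists s, P s]; [left|right].
  case/existsP: ex => s /and4P[cyc uq1 uq2 /allP sE].
  by exists s; split; rewrite ?size_tuple.
case=> s [/eqP sz cyc uq1 uq2 sE]; case/existsP: none.
by exists (Tuple sz); apply/and4P; split=> //; apply/allP.
Qed.

(** By the pigeonhole principle one colour has more than [k] triples; the search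
    covers red and blue by cycles of length [l + 2], and green by triangles. *)
Lemma small_ramsey (V : finType) (K : eqType) (c : {set V} -> K) (r b g : K)
    (S : {set V}) (n l k : nat) :
  (forall T, [|| c T == r, c T == b | c T == g]) -> #|S| = n.+1 ->
  uniq (triples n.+1) -> 3 * k < size (triples n.+1) ->
  unavoidable 1 [::] (triples n.+1) k.+1 ->
  unavoidable l [::] (triples n.+1) k.+1 ->
  [\/ berge_cycle (color_class c S r) l.+2, berge_cycle (color_class c S b) l.+2
    | berge_cycle (color_class c S g) 3].
Proof.
move=> cover cardS uq big un1 unl.
have [x0 x0S] : exists x, x \in S by apply/card_gt0P; rewrite cardS.
pose f := nth x0 (enum S).
have szS : size (enum S) = n.+1 by rewrite -cardE.
have injf : {in [pred i | i < n.+1] &, injective f}.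
  move=> i j; rewrite !inE -szS => lti ltj /eqP.
  by rewrite /f nth_uniq ?enum_uniq // => /eqP.
have fS i : i < n.+1 -> f i \in S by move=> lti; rewrite -mem_enum mem_nth ?szS.
have cover' : {in triples n.+1, forall t, [|| decode f t \in color_class c S r,
    decode f t \in color_class c S b | decode f t \in color_class c S g]}.
  move=> t /mem_triples[sz_t st /allP lt_t]; have := cover (decode f t).
  rewrite ![_ \in color_class _ _ _]inE.
  have -> : decode f t \subset S.
    by apply/subsetP=> v; rewrite inE => /mapP[i it ->]; apply: fS; apply: lt_t.
  rewrite cardsE (card_uniqP _) ?size_map ?sz_t // map_inj_in_uniq.
    exact: sorted_uniq ltn_trans ltnn _ st.
  by move=> i j /lt_t lti /lt_t ltj; apply: injf.
case/or3P: (majority cover' big) => many.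
- by apply: Or31; apply: decode_berge_cycle injf uq unl many.
- by apply: Or32; apply: decode_berge_cycle injf uq unl many.
- by apply: Or33; apply: decode_berge_cycle injf uq un1 many.
Qed.

Lemma extend_color (V : finType) (K : eqType) (c : {set V} -> K) (r b g : K)
    (S : {set V}) (x : V) (m : nat) :
  (forall T, [|| c T == r, c T == b | c T == g]) ->
  x \in S -> #|S| = m.+2 -> 4 < m ->
  ~ berge_cycle (color_class c S g) 3 ->
  {in S, forall y, 2 * #|nbrs S (link (color_class c S g) x) y| + 4 <= #|S|} ->
  berge_cycle (color_class c (S :\ x) r) m ->
  berge_cycle (color_class c S r) m.+1 \/ berge_cycle (color_class c S b) m.+1.
Proof.
move=> cover xS cardS m5 tri deg.
apply: (extend_or_switch _ _ _ _ _ xS cardS m5 tri deg).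
- exact: color_class_card.
- exact: color_class_card.
- move=> a d; rewrite !in_setD1 => /andP[ax aS] /andP[dx dS] ad.
  have := cover [set x; a; d]; rewrite /link ![_ \in color_class _ _ _]inE.
  have -> : [set x; a; d] \subset S.
    apply/subsetP=> v; rewrite !inE -orbA.
    by case/or3P=> /eqP->.
  rewrite -setUA cardsU1 cards2 !inE negb_or (eq_sym x a) (eq_sym x d).
  rewrite ax dx ad /=.
  by case/or3P=> ->; rewrite ?orbT.
- by apply: color_class_sub; apply: subsetDl.
by move=> T; rewrite inE => /and3P[].
Qed.

(** The cycle given by the induction hypothesis lives in [S - x], so its
    hyperedges avoid [x], as the insertion of [x] requires. *)
Theorem berge_ramsey (V : finType) (K : eqType) (c : {set V} -> K) (r b g : K)
    (n : nat) (S : {set V}) :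
  (forall T, [|| c T == r, c T == b | c T == g]) ->
  4 <= n -> #|S| = n.+1 ->
  [\/ berge_cycle (color_class c S r) n, berge_cycle (color_class c S b) n
    | berge_cycle (color_class c S g) 3].
Proof.
move=> cover; elim: n S => // n IH S n4 cardS.
have [n5|n5] := ltnP 4 n; last first.
  have [n3|n3] := ltnP 3 n.
    have En : n = 4 by move: n3 n5; clear; lia.
    have [un1 un3] := seven_triples_on_six; subst n.
    exact: small_ramsey cover cardS _ _ un1 un3.
  have En : n = 3 by move: n4 n3; clear; lia.
  have [un1 un2] := four_triples_on_five; subst n.
  exact: small_ramsey cover cardS _ _ un1 un2.
have [tri|tri] := berge_cycle_decidable (color_class c S g) 3; first exact: Or33.
have card3 := @color_class_card _ _ c S g.
have S6 : 6 < #|S| by rewrite cardS; move: n5; clear; lia.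
have [x xS deg] := small_codegree_vertex card3 tri S6.
have cardSx : #|S :\ x| = n.+1 by move: cardS; rewrite (cardsD1 x) xS => -[].
case: (IH _ (ltnW n5) cardSx) => [cyc|cyc|].
- have := extend_color cover xS cardS n5 tri deg cyc.
  by case=> ?; [apply: Or31|apply: Or32].
- have cover' T : [|| c T == b, c T == r | c T == g].
    by have := cover T; rewrite orbCA.
  have := extend_color cover' xS cardS n5 tri deg cyc.
  by case=> ?; [apply: Or32|apply: Or31].
move=> cyc; case: tri; apply: berge_cycle_sub cyc.
by apply: color_class_sub; apply: subsetDl.
Qed.

(** * Berge cycles as copies of members of the family *)

Lemma ordS_neq (l : nat) (i : 'I_l) : 1 < l -> ordS i != i.
Proof.
move=> l1; rewrite -val_eqE /=; have [lt|ge] := ltnP i.+1 l.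
  by rewrite modn_small // gtn_eqF.
have -> : i.+1 = l by apply/eqP; rewrite eqn_leq ge ltn_ord.
rewrite modnn ltn_eqF //; move: l1 ge; clear; lia.
Qed.

Lemma ordS2_neq (l : nat) (i : 'I_l) : 2 < l -> ordS (ordS i) != i.
Proof.
move=> l2; rewrite -val_eqE /=; have [lt|ge] := ltnP i.+1 l.
  rewrite (modn_small lt); have [lt2|ge2] := ltnP i.+2 l.
    by rewrite modn_small // gtn_eqF.
  have -> : i.+2 = l by apply/eqP; rewrite eqn_leq ge2 lt.
  rewrite modnn ltn_eqF //; move: l2 ge2; clear; lia.
have -> : i.+1 = l by apply/eqP; rewrite eqn_leq ge ltn_ord.
rewrite modnn modn_small ?ltn_eqF //; move: l2 ge; clear; lia.
Qed.

Lemma cycle_edge_mem (l : nat) (i : 'I_l) :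
  2 < l -> [set i; ordS i] \in gedges (cycle_graph l).
Proof.
by move=> l2; apply/imsetP; exists i; rewrite // inE ordS_neq // ltnW.
Qed.

Lemma cycle_edge_inj (l : nat) (i j : 'I_l) :
  2 < l -> [set i; ordS i] = [set j; ordS j] -> i = j.
Proof.
move=> l2 /setP E; move: (E i) (E (ordS i)); rewrite !inE !eqxx orbT /=.
case: eqP => //= _ /esym/eqP Ei; rewrite {1}Ei => /esym/orP[]/eqP ESi.
  by have := ordS2_neq j l2; rewrite ESi eqxx.
by have := ordS_neq (ordS j) (ltnW l2); rewrite -Ei ESi -Ei eqxx.
Qed.

Lemma berge_cycle_in_family (N l : nat) (E : {set {set 'I_N}}) :
  2 < l -> {in E, forall T : {set 'I_N}, #|T| = 3} -> berge_cycle E l ->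
  exists H, berge_family 3 (cycle_graph l) H /\
    exists f : hvert H -> 'I_N,
      injective f /\ forall h, h \in hedges H -> f @: h \in E.
Proof.
move=> l2 card3 [s [sz cyc uq1 uq2 sE]].
case: s => [|p0 s] in sz cyc uq1 uq2 sE; first by rewrite -sz in l2.
pose v (i : 'I_l) := nth p0.1 (unzip1 (p0 :: s)) i.
pose h (i : 'I_l) := nth p0.2 (unzip2 (p0 :: s)) i.
have vE i : v i = (nth p0 (p0 :: s) i).1 by rewrite /v (nth_map p0) // sz.
have hE i : h i = (nth p0 (p0 :: s) i).2 by rewrite /h (nth_map p0) // sz.
have injv : injective v.
  move=> i j /eqP; rewrite nth_uniq ?size_map ?sz // => /eqP; exact: val_inj.
have injh : injective h.
  move=> i j /eqP; rewrite nth_uniq ?size_map ?sz // => /eqP; exact: val_inj.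
have hin i : h i \in E by apply: sE; rewrite mem_nth // size_map sz.
have inc i : (v i \in h i) && (v (ordS i) \in h i).
  have lti : i < size (rcons s p0).
    by rewrite size_rcons -[(size s).+1]/(size (p0 :: s)) sz.
  have := cyc; rewrite /= => /(pathP p0)/(_ i lti); rewrite /incident.
  rewrite -rcons_cons nth_rcons sz ltn_ord -vE -hE => /andP[-> /=].
  suff -> : nth p0 (rcons s p0) i = nth p0 (p0 :: s) (ordS i) by rewrite -vE.
  have szs : (size s).+1 = l := sz.
  rewrite nth_rcons /=; have [lt|ge] := ltnP i (size s).
    by rewrite modn_small //; move: lt szs; clear; lia.
  have Ei : i = size s :> nat by apply/eqP; rewrite eqn_leq ge andbT -ltnS szs.
  by rewrite Ei eqxx szs modnn.
have nonempty : 0 < #|'I_N| by apply/card_gt0P; exists p0.1.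
have noset0 : set0 \notin [set h i | i : 'I_l].
  apply/negP=> /imsetP[i _ E0]; have := card3 _ (hin i).
  by rewrite -E0 cards0.
pose H := Hypergraph nonempty noset0.
pose Phi (e : {set 'I_l}) : {set 'I_N} :=
  if [pick i | e == [set i; ordS i]] is Some i then h i else set0.
have PhiE i : Phi [set i; ordS i] = h i.
  rewrite /Phi; case: pickP => [j /eqP /(cycle_edge_inj l2) -> //|/(_ i)].
  by rewrite eqxx.
exists H; split; last first.
  exists id; split=> // _ /imsetP[i _ ->]; by rewrite imset_id.
split; first by move=> _ /imsetP[i _ ->]; apply: card3.
exists v, Phi; split=> //.
- by move=> _ _ /imsetP[i _ ->] /imsetP[j _ ->]; rewrite !PhiE => /injh->.
- apply/setP=> T; apply/imsetP/imsetP=> [[_ /imsetP[i _ ->] ->]|[i _ ->]].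
    by exists i.
  by exists [set i; ordS i]; [apply: cycle_edge_mem|rewrite PhiE].
move=> _ /imsetP[i _ ->]; rewrite PhiE imsetU1 imset_set1.
have /andP[vi vSi] := inc i.
by apply/subsetP=> w /set2P[]->.
Qed.

(** * The lower bound *)

Lemma cycle_copy_size (N l t : nat) (c : {set 'I_N} -> 'I_t) (i : 'I_t)
    (H : hypergraph) :
  berge_family 3 (cycle_graph l) H -> monochromatic_copy 3 c i H -> l <= N.
Proof.
case=> _ [f [Phi [injf _ _ _]]] [k [injk _]].
by have := leq_card _ (inj_comp injk injf); rewrite !card_ord.
Qed.

Lemma spanning_cycle_copy (N l t : nat) (c : {set 'I_N} -> 'I_t) (i : 'I_t)
    (H : hypergraph) (w : 'I_N) :
  2 < l -> N <= l -> berge_family 3 (cycle_graph l) H ->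
  monochromatic_copy 3 c i H -> exists2 T : {set 'I_N}, w \in T & c T = i.
Proof.
move=> l2 leNl [_ [f [Phi [injf _ imPhi sub]]]] [k [injk mono]].
have := inj_card_onto (inj_comp injk injf) _ w; rewrite !card_ord => /(_ leNl).
case/codomP=> j /= wE; pose e := [set j; ordS j].
have eG : e \in gedges (cycle_graph l) by apply: cycle_edge_mem.
have PhiH : Phi e \in hedges H by rewrite -imPhi imset_f.
have [_ cE] := mono _ PhiH; exists (k @: Phi e) => //.
rewrite wE; apply: imset_f; apply: (subsetP (sub e eG)); apply: imset_f.
by rewrite !inE eqxx.
Qed.

(** Some vertex [w] of the triangle is neither [u] nor [v], and [uvw] is the
    only hyperedge available for the two edges of the triangle at [w]. *)
Lemma no_sunflower_triangle (N t : nat) (c : {set 'I_N} -> 'I_t) (i : 'I_t)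
    (H : hypergraph) (u v : 'I_N) :
  u != v -> (forall T, c T = i -> (u \in T) && (v \in T)) ->
  berge_family 3 (cycle_graph 3) H -> monochromatic_copy 3 c i H -> False.
Proof.
move=> uv only [_ [f [Phi [injf injPhi imPhi sub]]]] [k [injk mono]].
have injg := inj_comp injk injf.
have [a ga] : exists a : 'I_3, k (f a) \notin [set u; v].
  apply/existsP; apply: contraT => /existsPn all_uv.
  have : [set k (f a) | a : 'I_3] \subset [set u; v].
    by apply/subsetP=> _ /imsetP[a _ ->]; have := all_uv a; rewrite negbK.
  by move/subset_leq_card; rewrite (card_imset _ injg) card_ord cards2 uv.
have edge b : a \in [set b; ordS b] ->
    k @: Phi [set b; ordS b] = [set u; v; k (f a)].
  move=> ab; have eG := @cycle_edge_mem 3 b isT.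
  have PhiH : Phi [set b; ordS b] \in hedges H by rewrite -imPhi imset_f.
  have [] := mono _ PhiH; rewrite inE => /eqP card3 /only/andP[uT vT].
  apply/esym/eqP; rewrite eqEcard card3 setUC cardsU1 ga cards2 uv andbT.
  apply/subsetP=> w; rewrite inE in_set1 => /orP[/eqP->|/set2P[]->] //.
  apply: imset_f; apply: (subsetP (sub _ eG)); exact: imset_f.
have S3 : ordS (ordS (ordS a)) = a.
  by apply: val_inj; case: a {ga edge} => [[|[|[|]]]].
have a1 : a \in [set a; ordS a] by rewrite !inE eqxx.
have a2 : a \in [set ordS (ordS a); ordS (ordS (ordS a))].
  by rewrite S3 !inE eqxx orbT.
have /(imset_inj injk) := etrans (edge _ a1) (esym (edge _ a2)).
move/(injPhi _ _ (@cycle_edge_mem 3 _ isT) (@cycle_edge_mem 3 _ isT)).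
move/(@cycle_edge_inj 3 _ _ isT) => Ea.
by have := ordS2_neq a isT; rewrite -Ea eqxx.
Qed.

(** * The Ramsey number *)

Theorem theorem4 (n : nat) (hn : 4 <= n) :
  is_ramsey_number 3
    [:: berge_family 3 (cycle_graph n);
        berge_family 3 (cycle_graph n);
        berge_family 3 (cycle_graph 3)]
    (n + 1).
Proof.
have n2 : 2 < n by rewrite ltnW.
split=> [c|M].
  have found i l : 2 < l -> berge_cycle (color_class c setT i) l ->
      exists H, berge_family 3 (cycle_graph l) H /\ monochromatic_copy 3 c i H.
    move=> l2 cyc.
    have card3 := @color_class_card _ _ c setT i.
    have [H [fam [f [injf fE]]]] := berge_cycle_in_family l2 card3 cyc.
    exists H; split=> //; exists f; split=> // h /fE.
    by rewrite !inE => /and3P[_ -> /eqP].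
  have cover T : [|| c T == Ordinal (isT : 0 < 3), c T == Ordinal (isT : 1 < 3)
      | c T == Ordinal (isT : 2 < 3)].
    by case: (c T) => [[|[|[|]]]].
  have cardT : #|[set: 'I_(n + 1)]| = n.+1 by rewrite cardsT card_ord addn1.
  case: (berge_ramsey cover hn cardT) => /found.
  - by move=> /(_ n2)[H Hc]; exists (Ordinal (isT : 0 < 3)), H.
  - by move=> /(_ n2)[H Hc]; exists (Ordinal (isT : 1 < 3)), H.
  - by move=> /(_ isT)[H Hc]; exists (Ordinal (isT : 2 < 3)), H.
rewrite addn1 => arrow; rewrite ltnNge; apply/negP=> leMn.
case: M => [|[|M]] in arrow leMn.
(* With fewer than two vertices there is no room for a cycle. *)
- have [i [H [fam mono]]] := arrow (fun=> Ordinal (isT : 0 < 3)).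
  case: i fam mono => [[|[|[|]]]] //= _ fam /(cycle_copy_size fam) //;
    by rewrite leqNgt (ltn_trans _ n2).
- have [i [H [fam mono]]] := arrow (fun=> Ordinal (isT : 0 < 3)).
  case: i fam mono => [[|[|[|]]]] //= _ fam /(cycle_copy_size fam) //;
    by rewrite leqNgt (ltn_trans _ n2).
pose u : 'I_M.+2 := ord0; pose v : 'I_M.+2 := lift ord0 ord0.
pose c (T : {set 'I_M.+2}) : 'I_3 :=
  if u \notin T then Ordinal (isT : 0 < 3)
  else if v \notin T then Ordinal (isT : 1 < 3) else Ordinal (isT : 2 < 3).
have [i [H [fam mono]]] := arrow c.
case: i fam mono => [[|[|[|]]]] //= lti fam mono.
- have [T uT] := spanning_cycle_copy u n2 leMn fam mono.
  by rewrite /c uT; case: (v \in T).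
- have [T vT] := spanning_cycle_copy v n2 leMn fam mono.
  by rewrite /c vT; case: (u \in T).
apply: (no_sunflower_triangle (u := u) (v := v) _ _ fam mono) => // T.
by rewrite /c; case: (u \in T); case: (v \in T).
Qed.
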